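(* Let $g\ge 1$ and $k\ge 1$ be integers. The symmetric bilinear form $\mu^{\otimes 2k}$ on the space $(H_{\mathbb Q}^{\otimes 2k})^{\mathrm{Sp}}$ of symplectic invariant tensors is positive definite. Furthermore, there exist subspaces $U_\lambda\subset (H_{\mathbb Q}^{\otimes 2k})^{\mathrm{Sp}}$, indexed by the Young diagrams $\lambda$ with $|\lambda|=k$ and $h(\lambda)\le g$, such that $$(H_{\mathbb Q}^{\otimes 2k})^{\mathrm{Sp}}=\bigoplus_{|\lambda|=k,\ h(\lambda)\le g}U_\lambda$$ is a direct sum decomposition which is orthogonal with respect to $\mu^{\otimes 2k}$, and such that each $U_\lambda$ is an irreducible $\mathfrak S_{2k}$-submodule with $$U_\lambda\cong(\lambda^\delta)_{\mathfrak S_{2k}}.$$ In particular this is also the irreducible decomposition of the $\mathfrak S_{2k}$-module $(H_{\mathbb Q}^{\otimes 2k})^{\mathrm{Sp}}$.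
   Context: $H_{\mathbb Q}=H_1(\Sigma_g;\mathbb Q)$ is the standard symplectic $\mathbb Q$-vector space of dimension $2g$, with non-degenerate skew-symmetric form $\mu:H_{\mathbb Q}\otimes H_{\mathbb Q}\to\mathbb Q$ (intersection pairing); $\mathrm{Sp}=\mathrm{Sp}(2g,\mathbb Q)$ is its automorphism group. $(H_{\mathbb Q}^{\otimes 2k})^{\mathrm{Sp}}$ is the subspace of $\mathrm{Sp}$-invariants in $H_{\mathbb Q}^{\otimes 2k}$, where $\mathrm{Sp}$ acts diagonally. The symmetric group $\mathfrak S_{2k}$ acts on $H_{\mathbb Q}^{\otimes 2k}$, and hence on the invariants, by permuting tensor factors (the factor in position $i$ goes to position $\gamma(i)$). The bilinear form $\mu^{\otimes 2k}$ on $H_{\mathbb Q}^{\otimes 2k}$ is $(u_1\otimes\cdots\otimes u_{2k})\otimes(v_1\otimes\cdots\otimes v_{2k})\mapsto\prod_{i=1}^{2k}\mu(u_i,v_i)$; it is symmetric, and is restricted to the invariants. A Young diagram $\lambda=[\lambda_1\lambda_2\cdots\lambda_h]$ ($\lambda_1\ge\cdots\ge\lambda_h\geq 1$) has $|\lambda|=\lambda_1+\cdots+\lambda_h$ boxes and $h(\lambda)=h$ rows. For $|\nu|=d$, $\nu_{\mathfrak S_d}$ is the irreducible representation over $\mathbb Q$ of $\mathfrak S_d$ corresponding to $\nu$ (with the convention that $[d]_{\mathfrak S_d}$ is trivial and $[1^d]_{\mathfrak S_d}$ is the sign representation). For $|\lambda|=k$, $\lambda^\delta=[\lambda_1\lambda_1\lambda_2\lambda_2\cdots\lambda_h\lambda_h]$,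 a Young diagram with $2k$ boxes. *)

(* Defs.v *)
From HB Require Import structures.
From mathcomp Require Import all_boot all_order all_fingroup all_algebra.
From mathcomp Require Import mxrepresentation.

Set Implicit Arguments.
Unset Strict Implicit.
Unset Printing Implicit Defensive.

Import GRing.Theory Num.Theory.
Local Open Scope ring_scope.

(* H = rat^(2g) with its standard symplectic form, in a symplectic basis
   e_1, ..., e_g, f_1, ..., f_g.  Linear maps act on row vectors on the right. *)

Definition symp_mx (g : nat) : 'M[rat]_(g + g) :=
  block_mx 0 1%:M (- 1%:M) 0.

Definition mu (g : nat) (u v : 'rV[rat]_(g + g)) : rat :=
  (u *m symp_mx g *m v^T) 0 0.

Definition in_Sp (g : nat) (A : 'M[rat]_(g + g)) : Prop :=
  A \in unitmx /\ forall u v, mu (u *m A) (v *m A) = mu u v.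

(* The n-fold tensor power of rat^m, in coordinates: the standard basis is
   indexed by the words w : {ffun 'I_n -> 'I_m}, the word w standing for
   e_(w 0) (x) ... (x) e_(w (n - 1)). *)

Notation word n m := {ffun 'I_n -> 'I_m}.
Notation tensor n m := 'rV[rat]_#|{: word n m}|.

Definition pure (n m : nat) (u : 'I_n -> 'rV[rat]_m) : tensor n m :=
  \row_a \prod_(i < n) u i 0 ((enum_val a : word n m) i).

Definition tensor_mx (n m : nat) (A : 'M[rat]_m) : 'M[rat]_#|{: word n m}| :=
  \matrix_(a, b) \prod_(i < n)
    A ((enum_val a : word n m) i) ((enum_val b : word n m) i).

Definition mu_tensor (n g : nat) (s t : tensor n (g + g)) : rat :=
  (s *m tensor_mx n (symp_mx g) *m t^T) 0 0.

Definition sp_invariant (n g : nat) (t : tensor n (g + g)) : Prop :=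
  forall A : 'M[rat]_(g + g), in_Sp A -> t *m tensor_mx n A = t.

(* The factor in position i is moved to position x i.  Since (x * y) i = y (x i)
   for permutations, this is a right action, as required by
   mx_representation; it is the usual left action for the usual composition of
   permutations. *)
Definition place_mx (n m : nat) (x : 'S_n) : 'M[rat]_#|{: word n m}| :=
  \matrix_(a, b) [forall i, (enum_val b : word n m) (x i)
                              == (enum_val a : word n m) i]%:R.

(* These identities on pure tensors, which span, determine all of the above. *)

Lemma pure_delta (n m : nat) (w : word n m) :
  pure (fun i => delta_mx 0 (w i)) = delta_mx 0 (enum_rank w).
Proof.
apply/rowP=> b; rewrite !mxE eqxx /=.
have -> : (b == enum_rank w) = [forall i, (enum_val b : word n m) i == w i].
  apply/eqP/forallP => [-> i | eq_bw]; first by rewrite enum_rankK.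
  by apply: (canRL enum_valK); apply/ffunP=> i; apply/eqP.
case: forallP => [eq_bw | /forallP].
  by rewrite big1 // => i _; rewrite mxE eqxx eq_bw.
rewrite negb_forall => /existsP[i ne_bw].
by rewrite (bigD1 i) //= mxE eqxx (negPf ne_bw) mul0r.
Qed.

Lemma pure_tensor_mx (n m : nat) (u : 'I_n -> 'rV[rat]_m) (A : 'M[rat]_m) :
  pure u *m tensor_mx n A = pure (fun i => u i *m A).
Proof.
apply/rowP=> b; rewrite !mxE.
under eq_bigr => a _ do rewrite !mxE -big_split /=.
under [RHS]eq_bigr => i _ do rewrite mxE.
rewrite bigA_distr_bigA /= [RHS](reindex_onto enum_val enum_rank) /=; last first.
  by move=> w _; rewrite enum_rankK.
by apply: eq_big => [a | a _]; first by rewrite enum_valK eqxx.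
Qed.

Lemma mu_tensor_pure (n g : nat) (u v : 'I_n -> 'rV[rat]_(g + g)) :
  mu_tensor (pure u) (pure v) = \prod_(i < n) mu (u i) (v i).
Proof.
rewrite /mu_tensor pure_tensor_mx !mxE.
under eq_bigr => a _ do rewrite !mxE -big_split /=.
under [RHS]eq_bigr => i _ do rewrite /mu mxE.
rewrite bigA_distr_bigA /= [RHS](reindex_onto enum_val enum_rank) /=; last first.
  by move=> w _; rewrite enum_rankK.
apply: eq_big => [a | a _]; first by rewrite enum_valK eqxx.
by apply: eq_bigr => i _; rewrite [_^T _ _]mxE.
Qed.

Lemma place_mxE (n m : nat) (x : 'S_n) (t : tensor n m) (b : word n m) :
  (t *m place_mx m x) 0 (enum_rank b) = t 0 (enum_rank [ffun i => b (x i)]).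
Proof.
rewrite mxE (bigD1 (enum_rank [ffun i => b (x i)])) //= mxE !enum_rankK.
rewrite (_ : [forall i, _]) ?mulr1; last by apply/forallP=> i; rewrite ffunE.
rewrite big1 ?addr0 // => a ne_a; rewrite mxE enum_rankK.
case: forallP => [eq_b | _]; last by rewrite mulr0.
case/eqP: ne_a; apply: (canRL enum_valK); apply/ffunP=> i.
by rewrite ffunE (eqP (eq_b i)).
Qed.

Lemma pure_place_mx (n m : nat) (x : 'S_n) (u : 'I_n -> 'rV[rat]_m) :
  pure (fun i => u (x i)) *m place_mx m x = pure u.
Proof.
apply/rowP=> b; rewrite -(enum_valK b) place_mxE !mxE !enum_rankK.
rewrite [RHS](reindex_inj (@perm_inj _ x)) /=.
by apply: eq_bigr => i _; rewrite ffunE.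
Qed.

Lemma place_mx_repr (n m : nat) : mx_repr [set: 'S_n] (@place_mx n m).
Proof.
split=> [|x y _ _]; apply/row_matrixP=> a; rewrite [LHS]rowE [RHS]rowE.
  rewrite mulmx1; apply/rowP=> b; rewrite -(enum_valK b) place_mxE.
  by congr (_ _ (enum_rank _)); apply/ffunP=> i; rewrite ffunE perm1.
rewrite mulmxA; apply/rowP=> b; rewrite -(enum_valK b) !place_mxE.
by congr (_ _ (enum_rank _)); apply/ffunP=> i; rewrite !ffunE permM.
Qed.

Canonical place_repr (n m : nat) := MxRepresentation (place_mx_repr n m).

Definition is_young (d : nat) (s : seq nat) : bool :=
  [&& sorted geq s, 0%N \notin s & sumn s == d].

Record young (d : nat) :=
  Young { young_rows :> seq nat; youngP : is_young d young_rows }.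

HB.instance Definition _ (d : nat) := [isSub for @young_rows d].

Definition young_bseq (d : nat) (l : young d) : {bseq d of 'I_d.+1} :=
  insub_bseq d (map inord l).

Definition bseq_young (d : nat) (s : {bseq d of 'I_d.+1}) : option (young d) :=
  insub (map val s).

Lemma young_bseqK (d : nat) : pcancel (@young_bseq d) (@bseq_young d).
Proof.
case=> s ys; have /and3P[_ s0 /eqP sd] := ys.
have le_size : (size s <= d)%N.
  rewrite -sd sumnE -sum1_size !big_seq leq_sum // => i i_s.
  by rewrite lt0n; apply: contraNneq s0 => <-.
have le_d i : i \in s -> (i <= d)%N.
  by move=> i_s; rewrite -sd sumnE (big_rem i) //= leq_addr.
rewrite /bseq_young /young_bseq /insub_bseq insubdK; last first.
  by rewrite -topredE /= size_map.
rewrite -map_comp (_ : map _ s = s) /=; last first.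
  rewrite -[RHS]map_id; apply/eq_in_map => i i_s /=.
  by rewrite inordK ?ltnS ?le_d.
by rewrite insubT; congr Some; apply: val_inj.
Qed.

HB.instance Definition _ (d : nat) :=
  Finite.copy (young d) (pcan_type (@young_bseqK d)).

Definition height (d : nat) (l : young d) : nat := size l.

Definition delta_rows (s : seq nat) : seq nat :=
  flatten [seq [:: r; r] | r <- s].

Lemma delta_rowsP (k : nat) (l : young k) : is_young k.*2 (delta_rows l).
Proof.
case: l => s /= /and3P[s_sorted s0 /eqP <-]; apply/and3P; split.
- case: s s_sorted {s0} => //= a s; rewrite /geq /= leqnn /=.
  by elim: s a => //= b s IHs a /andP[-> /IHs]; rewrite leqnn.
- apply: contra s0 => /flatten_mapP[r r_s].
  by rewrite !inE orbb => /eqP->.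
- apply/eqP; elim: s {s_sorted s0} => //= a s IHs.
  by rewrite -/(delta_rows s) IHs doubleD addnA addnn.
Qed.

Definition young_delta (k : nat) (l : young k) : young k.*2 :=
  Young (delta_rowsP l).

(* Specht modules.  The boxes of the diagram l are numbered 0, ..., d - 1 along
   the rows, from the top row down: box i is in row reshape_index l i and in
   column reshape_offset l i. *)

Definition row_stab (d : nat) (l : seq nat) : {set 'S_d} :=
  [set x : 'S_d | [forall i, reshape_index l (x i) == reshape_index l i]].

Definition col_stab (d : nat) (l : seq nat) : {set 'S_d} :=
  [set x : 'S_d | [forall i, reshape_offset l (x i) == reshape_offset l i]].

Definition Sym_regular (d : nat) := regular_repr rat [set: 'S_d]%G.

(* \sum_(p, q) sgn(q) pq for the usual composition of permutations, i.e., q * p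
   for the product of 'S_d; the usual left ideal that it generates is then the
   right submodule of the regular representation. *)
Definition young_symmetrizer (d : nat) (l : seq nat) :
    'rV[rat]_#|[set: 'S_d]| :=
  \sum_(p in row_stab d l) \sum_(q in col_stab d l)
    (-1) ^+ (odd_perm q)
      *: delta_mx 0 (gring_index [set: 'S_d]%G (q * p)%g).

Definition specht_mx (d : nat) (l : young d) : 'M[rat]_#|[set: 'S_d]| :=
  cyclic_mx (Sym_regular d) (young_symmetrizer d l).

Lemma specht_mx_module (d : nat) (l : young d) :
  mxmodule (Sym_regular d) (specht_mx l).
Proof. exact: cyclic_mx_module. Qed.

Definition specht_repr (d : nat) (l : young d) :=
  submod_repr (specht_mx_module l).

(* Normalization: [d] gives the trivial representation, [1^d] the sign. *)

Lemma delta_regular (d : nat) (x y : 'S_d) :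
  delta_mx 0 (gring_index [set: 'S_d]%G x) *m Sym_regular d y
    = delta_mx 0 (gring_index [set: 'S_d]%G (x * y)%g) :> 'rV_#|[set: 'S_d]|.
Proof. by rewrite -rowE rowK gring_indexK ?inE. Qed.

Lemma reshape_row (d i : nat) : (i < d)%N ->
  reshape_index [:: d] i = 0%N /\ reshape_offset [:: d] i = i.
Proof.
move=> lt_id; have idx : reshape_index [:: d] i = 0%N.
  have := @reshape_indexP [:: d] i; rewrite /= addn0 => /(_ lt_id).
  by case: reshape_index.
by split=> //; rewrite /reshape_offset idx /= subn0.
Qed.

Lemma reshape_col (d i : nat) : (i < d)%N ->
  reshape_index (nseq d 1%N) i = i /\ reshape_offset (nseq d 1%N) i = 0%N.
Proof.
move=> lt_id; have sum_d : sumn (nseq d 1%N) = d by rewrite sumn_nseq mul1n.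
have off : reshape_offset (nseq d 1%N) i = 0%N.
  have := @reshape_indexP (nseq d 1%N) i; rewrite sum_d size_nseq => lt_r.
  have := @reshape_offsetP (nseq d 1%N) i; rewrite sum_d => /(_ lt_id).
  by rewrite nth_nseq lt_r // ltnS leqn0 => /eqP.
split=> //; have := reshape_indexK (nseq d 1%N) i; rewrite off.
rewrite /flatten_index addn0 take_nseq ?sumn_nseq ?mul1n //.
by have := @reshape_indexP (nseq d 1%N) i; rewrite sum_d size_nseq => /(_ lt_id)/ltnW.
Qed.

Lemma young_symmetrizer_row (d : nat) (x : 'S_d) :
  young_symmetrizer d [:: d] *m Sym_regular d x = young_symmetrizer d [:: d].
Proof.
have -> : young_symmetrizer d [:: d]
            = \sum_(p : 'S_d) delta_mx 0 (gring_index [set: 'S_d]%G p).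
  apply: eq_big => [p | p _].
    rewrite inE; apply/forallP=> i.
    by rewrite !(proj1 (reshape_row (ltn_ord _))).
  rewrite (big_pred1 1%g) ?odd_perm1 ?scale1r ?mul1g // => q.
  rewrite inE; apply/forallP/eqP=> [fix_q | -> i]; last by rewrite perm1.
  apply/permP=> i; rewrite perm1; apply: val_inj; have := fix_q i.
  by rewrite !(proj2 (reshape_row (ltn_ord _))) => /eqP.
rewrite mulmx_suml [RHS](reindex_inj (mulIg x)) /=.
by apply: eq_bigr => p _; rewrite delta_regular.
Qed.

Lemma young_symmetrizer_col (d : nat) (x : 'S_d) :
  young_symmetrizer d (nseq d 1%N) *m Sym_regular d x
    = (-1) ^+ (odd_perm x) *: young_symmetrizer d (nseq d 1%N).
Proof.
have -> : young_symmetrizer d (nseq d 1%N)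
            = \sum_(q : 'S_d) (-1) ^+ (odd_perm q)
                *: delta_mx 0 (gring_index [set: 'S_d]%G q).
  rewrite /young_symmetrizer (big_pred1 1%g) => [|p].
    apply: eq_big => [q | q _]; last by rewrite mulg1.
    rewrite inE; apply/forallP=> i.
    by rewrite !(proj2 (reshape_col (ltn_ord _))).
  rewrite inE; apply/forallP/eqP=> [fix_p | -> i]; last by rewrite perm1.
  apply/permP=> i; rewrite perm1; apply: val_inj; have := fix_p i.
  by rewrite !(proj1 (reshape_col (ltn_ord _))) => /eqP.
rewrite mulmx_suml scaler_sumr [RHS](reindex_inj (mulIg x)) /=.
apply: eq_bigr => q _; rewrite -scalemxAl delta_regular scalerA.
by rewrite odd_permM -signr_addb addbCA addbb addbF.
Qed.

(* Main.v *)
(* Let a_nu, b_nu be the row symmetrizer and the column antisymmetrizer of nu,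
   acting on the right, and c_nu = b_nu a_nu.  The matrix of mu is itself
   symplectic, so on invariant tensors the form is the standard dot product, for
   which the symmetric group acts orthogonally.  This gives positivity, and the
   identities c_nu x c_nu' = 0 for nu != nu' and c_nu x c_nu = K(x) c_nu with
   K(1) != 0 then show that any t c_nu != 0 generates an irreducible module
   isomorphic to the Specht module of nu, orthogonal to those of other shapes.

   The first fundamental theorem for Sp is not used.  For an invariant t, the
   coefficient of t b_nu at the highest weight word is scaled by a character when
   a triangular matrix acts on t b_nu; as products of a triangular and a symplectic
   matrix are dense in all matrices (symplectic Gram-Schmidt), this coefficient
   determines t c_nu.  So the tensors t c_nu form a space of dimension at most 1,
   which the diagonal symplectic matrices force to be 0 unless nu is some
   lambda^delta with h(lambda) <= g, and in that case the product of the contractions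
   along the vertical dominoes of nu shows that it is not 0.

   It remains that a vector u with u x c_nu = 0 for all x and nu is 0; this is
   applied to the orthogonal complement of the sum of the U_lambda.  If u != 0 there
   is a nonzero w fixed by the row stabilizer of some nu, and with the rows chosen as
   unequal as possible the transposes of w moving a given box up into a given row add
   up to -w (raising).  Then w b_nu = 0 implies w = 0, by removing the boxes of nu
   from b_nu one by one. *)

Require Import Defs.
From mathcomp Require Import all_boot all_order all_fingroup all_algebra.
From mathcomp Require Import mxrepresentation.
From mathcomp Require Import zify ring lra.

Set Implicit Arguments.
Unset Strict Implicit.
Unset Printing Implicit Defensive.

Import Order.TTheory GRing.Theory Num.Theory.
Local Open Scope ring_scope.

(** * Boxes of Young diagrams *)

Notation box_row l i := (reshape_index l (nat_of_ord i)).
Notation box_col l i := (reshape_offset l (nat_of_ord i)).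

Section Boxes.
Local Open Scope nat_scope.
Variables (d : nat) (l : young d).

Lemma young_sumn : sumn l = d.
Proof. by case: l => s /= /and3P[_ _ /eqP]. Qed.

Lemma young_nth_leq r s : r <= s -> nth 0 l s <= nth 0 l r.
Proof.
move=> le_rs; case: (ltnP s (size l)) => [lt_s | /(nth_default 0)->//].
case: l lt_s => t /= /and3P[srt _ _] lt_s.
have geq_tr : transitive geq by move=> a b c /= ba ac; apply: leq_trans ac ba.
have := sorted_leq_nth geq_tr (fun n => leqnn n) 0 srt.
by apply=> //; rewrite inE; apply: leq_ltn_trans lt_s.
Qed.

Lemma young_nth_gt0 r : (0 < nth 0 l r) = (r < size l).
Proof.
case: (ltnP r (size l)) => [lt_r | /(nth_default 0)->//].
case: l lt_r => t /= /and3P[_ t0 _] lt_r; rewrite lt0n.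
by apply: contra t0 => /eqP <-; apply: mem_nth.
Qed.

Lemma box_row_lt (i : 'I_d) : box_row l i < size l.
Proof. by apply: reshape_indexP; rewrite young_sumn. Qed.

Lemma box_col_lt (i : 'I_d) : box_col l i < nth 0 l (box_row l i).
Proof. by apply: reshape_offsetP; rewrite young_sumn. Qed.

Lemma box_row_lt_size (i : 'I_d) : box_row l i < d.
Proof.
apply: leq_ltn_trans (ltn_ord i); rewrite -{2}(reshape_indexK l i) /flatten_index.
apply: leq_trans (leq_addr _ _); have := box_row_lt i.
move: (box_row l i) => r lt_r; rewrite sumnE big_seq.
have sz : size (take r l) = r by rewrite size_takel // ltnW.
rewrite -{1}sz -sum1_size big_seq leq_sum // => x /mem_take xl.
by rewrite lt0n; have /and3P[_ l0 _] := youngP l; apply: contraNneq l0 => <-.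
Qed.

Lemma box_inj (i j : 'I_d) :
  box_row l i = box_row l j -> box_col l i = box_col l j -> i = j.
Proof.
move=> eq_r eq_c; apply: val_inj.
by rewrite /= -(reshape_indexK l i) -(reshape_indexK l j) eq_r eq_c.
Qed.

Lemma box_exists r c : c < nth 0 l r ->
  exists i : 'I_d, box_row l i = r /\ box_col l i = c.
Proof.
move=> lt_c; have := flatten_indexP lt_c; rewrite young_sumn => lt_d.
by exists (Ordinal lt_d); rewrite /= flatten_indexKl ?flatten_indexKr.
Qed.

Lemma box_up (i : 'I_d) r : r <= box_row l i ->
  exists j : 'I_d, box_row l j = r /\ box_col l j = box_col l i.
Proof.
move=> le_r; apply: box_exists; apply: leq_trans (box_col_lt i) _.
exact: young_nth_leq.
Qed.

Lemma box_left (i : 'I_d) c : c <= box_col l i ->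
  exists j : 'I_d, box_row l j = box_row l i /\ box_col l j = c.
Proof.
by move=> le_c; apply: box_exists; apply: leq_ltn_trans (box_col_lt i).
Qed.

Lemma card_box_row r : #|[pred i : 'I_d | box_row l i == r]| = nth 0 l r.
Proof.
pose f (i : 'I_d) : option 'I_(nth 0 l r) := insub (box_col l i).
rewrite -[RHS]card_ord -[RHS](card_imset _ (@Some_inj _)) -(card_in_imset (f := f)).
  apply: eq_card => o; apply/imsetP/imsetP => -[].
    move=> i; rewrite inE => /eqP ri ->; have lt_c : box_col l i < nth 0 l r.
      by rewrite -ri box_col_lt.
    by exists (Ordinal lt_c); rewrite // /f insubT.
  move=> c _ ->; have [i [ri ci]] := box_exists (ltn_ord c).
  exists i; first by rewrite inE ri.
  by rewrite /f ci valK.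
move=> i j; rewrite !inE /f => /eqP ri /eqP rj.
have hi : box_col l i < nth 0 l r by rewrite -ri box_col_lt.
have hj : box_col l j < nth 0 l r by rewrite -rj box_col_lt.
by rewrite !insubT => -[] ec; apply: box_inj; rewrite ?ri.
Qed.

End Boxes.

Lemma eq_nth_notin0 (s1 s2 : seq nat) : 0%N \notin s1 -> 0%N \notin s2 ->
  (forall r, nth 0%N s1 r = nth 0%N s2 r) -> s1 = s2.
Proof.
have le_size (t1 t2 : seq nat) : 0%N \notin t1 ->
    (forall r, nth 0%N t1 r = nth 0%N t2 r) -> (size t1 <= size t2)%N.
  move=> t1_0 eq_t; rewrite leqNgt; apply: contra t1_0 => lt_t.
  by rewrite -[0%N](nth_default 0%N (leqnn (size t2))) -eq_t mem_nth.
move=> s1_0 s2_0 eq_s; apply: (@eq_from_nth _ 0%N) => //.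
by apply/eqP; rewrite eqn_leq !le_size.
Qed.

Lemma young_eq (d : nat) (l l' : young d) :
  (forall r, nth 0%N l r = nth 0%N l' r) -> l = l'.
Proof.
move=> eq_n; apply: val_inj; apply: eq_nth_notin0 eq_n.
  by have /and3P[] := youngP l.
by have /and3P[] := youngP l'.
Qed.

Section MinSum.
Local Open Scope nat_scope.

(* Distinct naturals have the least sum when they fill an initial segment. *)
Lemma uniq_sumn_min (s : seq nat) : uniq s ->
  \sum_(r < size s) r <= sumn s ?= iff all (gtn (size s)) s.
Proof.
elim: {s}(size s) {-2}s (erefl (size s)) => [|n IHn] s size_s us.
  by case: s size_s us => // _ _; rewrite big_ord0; split.
have nz_s : 0 < size s by rewrite size_s.
(* Removing the maximum [m] leaves n distinct naturals for the induction. The pigeonhole principle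
   gives [n <= m], and equality of the sums forces [m = n]. *)
pose m := \max_(x <- s) x.
have le_m x : x \in s -> x <= m by move=> xs; apply: leq_bigmax_seq.
have ms : m \in s.
  rewrite /m; case: s nz_s {size_s us m le_m} => // a s _.
  elim: s a => [|b s IHs] a; first by rewrite big_seq1 mem_head.
  rewrite big_cons; case: (leqP a (\max_(j <- b :: s) j)) => h.
    by rewrite inE IHs orbT.
  by rewrite mem_head.
have le_nm : n <= m.
  have sub : {subset s <= iota 0 m.+1}.
    by move=> x /le_m; rewrite mem_iota add0n ltnS.
  by have := uniq_leq_size us sub; rewrite size_iota size_s ltnS.
have srem : size (rem m s) = n by rewrite size_rem // size_s.
have [le_rem eq_rem] := IHn _ srem (rem_uniq m us).
have sumE : sumn s = m + sumn (rem m s).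
  by rewrite (perm_sumn (perm_to_rem ms)).
rewrite size_s big_ord_recr /= sumE addnC; split.
  by rewrite leq_add // -srem.
rewrite srem in le_rem eq_rem.
apply/eqP/idP => [eq_sum | /allP lt_n].
  have eqm : m = n.
    apply/eqP; rewrite eqn_leq le_nm andbT.
    by rewrite -(leq_add2r (sumn (rem m s))) -eq_sum leq_add2l.
  apply/allP=> x /le_m; rewrite eqm /= => ?; lia.
have eqm : m = n by have := lt_n _ ms; rewrite /=; lia.
rewrite eqm in ms le_rem eq_rem sumE *.
congr (_ + _); apply/eqP; rewrite eq_rem; apply/allP=> x.
rewrite mem_rem_uniq // !inE => /andP[ne_x /lt_n] /=; lia.
Qed.

End MinSum.

Section Match.
Local Open Scope nat_scope.
Variables (d : nat) (nu rho : young d) (z : 'S_d).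

Lemma box_col_lt_size (i : 'I_d) : box_col nu i < d.
Proof. exact: leq_ltn_trans (leq_subr _ _) (ltn_ord i). Qed.

Let column c := [seq i <- enum 'I_d | box_col nu i == c].

Let mem_column c i : (i \in column c) = (box_col nu i == c).
Proof. by rewrite mem_filter mem_enum andbT. Qed.

Let column_uniq c : uniq (column c).
Proof. exact: filter_uniq (enum_uniq _). Qed.

Let rows c := [seq box_row nu i | i <- column c].

Let rows_uniq c : uniq (rows c).
Proof.
rewrite map_inj_in_uniq ?column_uniq // => i j.
by rewrite !mem_column => /eqP ci /eqP cj eq_r; exact: box_inj eq_r (etrans ci (esym cj)).
Qed.

Let rows_down c r s : r <= s -> s \in rows c -> r \in rows c.
Proof.
move=> le_rs /mapP[i]; rewrite mem_column => /eqP ci def_s.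
have [j [rj cj]] : exists j : 'I_d, box_row nu j = r /\ box_col nu j = box_col nu i.
  by apply: box_up; rewrite -def_s.
by apply/mapP; exists j; rewrite ?mem_column ?cj ?ci.
Qed.

Let rowsE c r : (r \in rows c) = (r < size (column c)).
Proof.
rewrite -(size_map (fun i : 'I_d => box_row nu i) (column c)) -/(rows c).
apply/idP/idP => [r_c | ].
  rewrite -[r.+1](size_iota 0) uniq_leq_size ?iota_uniq // => s.
  by rewrite mem_iota add0n ltnS => le_s; apply: rows_down r_c.
apply: contraLR => r'c; rewrite -leqNgt -[X in _ <= X](size_iota 0).
apply: uniq_leq_size => // s s_c; rewrite mem_iota add0n ltnNge.
by apply: contra r'c => le_rs; apply: rows_down s_c.
Qed.

(** When this fails, a transposition kills the product of the column antisymmetrizer of [nu], [z]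
    and the row symmetrizer of [rho]; so every nonzero product of this kind satisfies it. *)
Hypothesis z_distinct : forall i j : 'I_d, box_col nu i = box_col nu j ->
  box_row rho (z i) = box_row rho (z j) -> i = j.

Let imgs c := [seq box_row rho (z i) | i <- column c].

Let imgs_uniq c : uniq (imgs c).
Proof.
rewrite map_inj_in_uniq ?column_uniq // => i j.
rewrite !mem_column => /eqP ci /eqP cj eq_r.
exact: z_distinct (etrans ci (esym cj)) eq_r.
Qed.

Let sum_columns (F : 'I_d -> nat) :
  \sum_i F i = \sum_(c < d) sumn [seq F i | i <- column c].
Proof.
pose col i := Ordinal (box_col_lt_size i).
rewrite (partition_big col xpredT) //=; apply: eq_bigr => c _.
by rewrite sumnE big_map big_filter big_enum_cond; apply: eq_bigl => i.
Qed.

Let sum_rho : \sum_(i < d) box_row rho i = \sum_(c < d) sumn (imgs c).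
Proof. by rewrite (reindex_inj (@perm_inj _ z)) sum_columns. Qed.

Let sum_nu : \sum_(i < d) box_row nu i = \sum_(c < d) \sum_(r < size (imgs c)) r.
Proof.
rewrite sum_columns; apply: eq_bigr => c _; apply/esym/eqP.
have := uniq_sumn_min (rows_uniq c); rewrite !size_map => -[_ ->].
by apply/allP=> r; rewrite rowsE.
Qed.

Let sum_leqif := leqif_sum (fun (c : 'I_d) (_ : true) => uniq_sumn_min (imgs_uniq c)).

(* On each column of nu the rows of the images are distinct, so their sum is least
   when they fill an initial segment, as the rows of the column itself do. *)
Lemma young_distinct_leq :
  \sum_(i < d) box_row nu i <= \sum_(i < d) box_row rho i.
Proof. by rewrite sum_nu sum_rho sum_leqif. Qed.

(** The reverse inequality forces equality in every column, so the images of a column of [nu] meet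
    exactly the rows whose indices are below the length of that column. *)
Lemma young_distinct_match :
  \sum_(i < d) box_row rho i <= \sum_(i < d) box_row nu i ->
  forall i : 'I_d, exists j : 'I_d,
    box_col nu j = box_col nu i /\ box_row nu j = box_row rho (z i).
Proof.
move=> le_sum i.
have := sum_leqif.2; rewrite -sum_nu -sum_rho eqn_leq young_distinct_leq le_sum /=.
move/esym/forallP/(_ (Ordinal (box_col_lt_size i)))/allP/(_ (box_row rho (z i))).
rewrite /= size_map => lt_i.
have /lt_i : box_row rho (z i) \in imgs (box_col nu i).
  by apply/mapP; exists i; rewrite ?mem_column.
by rewrite -rowsE => /mapP[j]; rewrite mem_column => /eqP cj ->; exists j.
Qed.

(** The boxes given by [young_distinct_match] define [q], injective by the hypothesis on [z]. Then
    [z^-1 * q] carries row r of [rho] onto row r of [nu], so the row lengths agree. *)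
Lemma young_distinct_eq :
  \sum_(i < d) box_row rho i <= \sum_(i < d) box_row nu i ->
  nu = rho
  /\ exists q : 'S_d, (forall i, box_col nu (q i) = box_col nu i)
       /\ (forall i, box_row nu (q i) = box_row rho (z i)).
Proof.
move=> le_sum; have /fin_all_exists[q qP] := young_distinct_match le_sum.
have q_inj : injective q.
  move=> i j eq_q; apply: z_distinct.
    by rewrite -(qP i).1 -(qP j).1 eq_q.
  by rewrite -(qP i).2 -(qP j).2 eq_q.
split; last by exists (perm q_inj); split=> i; rewrite permE; have [] := qP i.
apply: young_eq => r; rewrite -!card_box_row.
pose p := (z^-1 * perm q_inj)%g.
rewrite -(card_imset [pred i : 'I_d | box_row rho i == r] (@perm_inj _ p)).
apply: eq_card => i; rewrite inE; apply/idP/imsetP => [ri | [j rj ->]].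
  exists (p^-1 i)%g; last by rewrite permKV.
  rewrite inE invMg invgK permM -(qP _).2.
  by rewrite (_ : q _ = i) // -[RHS](permKV (perm q_inj)) permE.
by move: rj; rewrite inE permM permE (qP _).2 permKV.
Qed.

End Match.

(** * Young symmetrizers *)

Lemma dotvv_eq0 (R : realDomainType) n (u : 'rV[R]_n) :
  ((u *m u^T) 0 0 == 0) = (u == 0).
Proof.
apply/idP/eqP => [|->]; last by rewrite mul0mx mxE.
rewrite mxE psumr_eq0 => [/allP u0|i _]; last by rewrite mxE -expr2 sqr_ge0.
apply/rowP=> i; have := u0 i (mem_index_enum i).
by rewrite !mxE -expr2 sqrf_eq0 => /eqP.
Qed.

Lemma dotvv_gt0 (R : realDomainType) n (u : 'rV[R]_n) :
  u != 0 -> 0 < (u *m u^T) 0 0.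
Proof.
rewrite lt0r dotvv_eq0 => -> /=.
by rewrite mxE sumr_ge0 // => i _; rewrite mxE -expr2 sqr_ge0.
Qed.

Lemma mulmx_tr_eq0 (R : realDomainType) m n (A : 'M[R]_(m, n)) :
  A *m A^T = 0 -> A = 0.
Proof.
move=> AA0; apply/row_matrixP=> i; apply/eqP; rewrite row0 -dotvv_eq0.
by rewrite rowE trmx_mul mulmxA -(mulmxA _ A) AA0 mulmx0 mul0mx mxE.
Qed.

Lemma eq_oppmx_eq0 (R : realFieldType) m n (A : 'M[R]_(m, n)) : A = - A -> A = 0.
Proof.
by move=> /matrixP eqA; apply/matrixP=> i j; have := eqA i j; rewrite !mxE; lra.
Qed.

Section Stabilizers.
Variables (d : nat) (l : seq nat).

Lemma row_stabP (x : 'S_d) :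
  reflect (forall i, box_row l (x i) = box_row l i) (x \in row_stab d l).
Proof. by rewrite inE; apply: (iffP forallP) => xP i; apply/eqP. Qed.

Lemma col_stabP (x : 'S_d) :
  reflect (forall i, box_col l (x i) = box_col l i) (x \in col_stab d l).
Proof. by rewrite inE; apply: (iffP forallP) => xP i; apply/eqP. Qed.

Lemma row_stab_group : group_set (row_stab d l).
Proof.
apply/group_setP; split=> [|x y /row_stabP xP /row_stabP yP]; apply/row_stabP=> i.
  by rewrite perm1.
by rewrite permM yP xP.
Qed.
Canonical row_stab_gr := Group row_stab_group.

Lemma col_stab_group : group_set (col_stab d l).
Proof.
apply/group_setP; split=> [|x y /col_stabP xP /col_stabP yP]; apply/col_stabP=> i.
  by rewrite perm1.
by rewrite permM yP xP.
Qed.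
Canonical col_stab_gr := Group col_stab_group.

Lemma row_stab_tperm (i j : 'I_d) :
  box_row l i = box_row l j -> tperm i j \in row_stab d l.
Proof. by move=> eq_ij; apply/row_stabP=> h; case: tpermP => // ->. Qed.

Lemma col_stab_tperm (i j : 'I_d) :
  box_col l i = box_col l j -> tperm i j \in col_stab d l.
Proof. by move=> eq_ij; apply/col_stabP=> h; case: tpermP => // ->. Qed.

End Stabilizers.

Section YoungOps.
Variables (d n : nat) (rG : mx_representation rat [set: 'S_d]%G n).

Lemma perm_reprM x y : rG (x * y)%g = rG x *m rG y.
Proof. by rewrite repr_mxM ?inE. Qed.

(** [row_op], [col_op] and [young_op] are a_nu, b_nu and c_nu as matrices in an arbitrary
    representation [rG]. *)
Definition row_op (l : seq nat) : 'M_n := \sum_(p in row_stab d l) rG p.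

Definition col_op (l : seq nat) : 'M_n :=
  \sum_(q in col_stab d l) (-1) ^+ (odd_perm q) *: rG q.

Definition young_op (l : seq nat) : 'M_n := col_op l *m row_op l.

Lemma mul_repr_row_op l p : p \in row_stab d l -> rG p *m row_op l = row_op l.
Proof.
move=> Rp; rewrite /row_op mulmx_sumr [RHS](reindex_inj (mulgI p)) /=.
by apply: eq_big => [x | x _]; rewrite ?groupMl // perm_reprM.
Qed.

Lemma mul_row_op_repr l p : p \in row_stab d l -> row_op l *m rG p = row_op l.
Proof.
move=> Rp; rewrite /row_op mulmx_suml [RHS](reindex_inj (mulIg p)) /=.
by apply: eq_big => [x | x _]; rewrite ?groupMr // perm_reprM.
Qed.

Lemma mul_repr_col_op l q : q \in col_stab d l ->
  rG q *m col_op l = (-1) ^+ (odd_perm q) *: col_op l.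
Proof.
move=> Rq; rewrite /col_op mulmx_sumr scaler_sumr [RHS](reindex_inj (mulgI q)) /=.
apply: eq_big => [x | x _]; first by rewrite groupMl.
by rewrite perm_reprM odd_permM scalerA -scalemxAr signr_addb signrMK.
Qed.

Lemma mul_col_op_repr l q : q \in col_stab d l ->
  col_op l *m rG q = (-1) ^+ (odd_perm q) *: col_op l.
Proof.
move=> Rq; rewrite /col_op mulmx_suml scaler_sumr [RHS](reindex_inj (mulIg q)) /=.
apply: eq_big => [x | x _]; first by rewrite groupMr.
rewrite perm_reprM odd_permM scalerA -scalemxAl signr_addb.
by rewrite mulrC -mulrA -signr_addb addbb mulr1.
Qed.

Lemma row_op_sqr l : row_op l *m row_op l = #|row_stab d l|%:R *: row_op l.
Proof.
rewrite {1}/row_op mulmx_suml (eq_bigr (fun=> row_op l)).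
  by rewrite sumr_const scaler_nat.
by move=> p; apply: mul_repr_row_op.
Qed.

Lemma col_op_sqr l : col_op l *m col_op l = #|col_stab d l|%:R *: col_op l.
Proof.
rewrite {1}/col_op mulmx_suml (eq_bigr (fun=> col_op l)).
  by rewrite sumr_const scaler_nat.
by move=> q Cq; rewrite -scalemxAl mul_repr_col_op // signrZK.
Qed.

Lemma card_stab_neq0 (A : {group 'S_d}) : #|A|%:R != 0 :> rat.
Proof. by rewrite pnatr_eq0 -lt0n cardG_gt0. Qed.

(** The transposition of i and j is absorbed on the left with sign -1; moved past [z] it becomes the
    transposition of [z i] and [z j], absorbed on the right with sign +1. *)
Lemma col_repr_row_eq0 (nu rho : seq nat) (z : 'S_d) (i j : 'I_d) : i != j ->
    box_col nu i = box_col nu j -> box_row rho (z i) = box_row rho (z j) ->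
  col_op nu *m rG z *m row_op rho = 0.
Proof.
move=> ne_ij eq_c eq_r; set X := _ *m _.
have defX : X = - X.
  have swap : (tperm i j * z = z * tperm (z i) (z j))%g by rewrite -tpermJ conjgC.
  rewrite {1}/X -(mul_repr_row_op (row_stab_tperm eq_r)) mulmxA -(mulmxA (col_op _)).
  rewrite -perm_reprM -swap perm_reprM mulmxA mul_col_op_repr ?col_stab_tperm //.
  by rewrite odd_tperm ne_ij expr1 scaleN1r !mulNmx.
exact: eq_oppmx_eq0 defX.
Qed.

Lemma col_repr_row_distinct (nu rho : seq nat) (z : 'S_d) :
    col_op nu *m rG z *m row_op rho != 0 ->
  forall i j : 'I_d, box_col nu i = box_col nu j ->
    box_row rho (z i) = box_row rho (z j) -> i = j.
Proof.
move=> nz i j eq_c eq_r; apply/eqP; apply: contraR nz => ne_ij.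
by rewrite (col_repr_row_eq0 ne_ij).
Qed.

Lemma row_repr_colE (nu rho : seq nat) x :
  row_op nu *m rG x *m col_op rho =
    \sum_(p in row_stab d nu) \sum_(q in col_stab d rho)
      (-1) ^+ (odd_perm q) *: rG (p * x * q)%g.
Proof.
rewrite /row_op !mulmx_suml; apply: eq_bigr => p _; rewrite /col_op mulmx_sumr.
by apply: eq_bigr => q _; rewrite -scalemxAr -!perm_reprM.
Qed.

Lemma young_op_reprE (nu rho : seq nat) x :
  young_op nu *m rG x *m young_op rho =
    \sum_(p in row_stab d nu) \sum_(q in col_stab d rho)
      (-1) ^+ (odd_perm q) *: (col_op nu *m rG (p * x * q)%g *m row_op rho).
Proof.
rewrite /young_op mulmxA -[_ *m rG x]mulmxA -[_ *m col_op rho]mulmxA row_repr_colE.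
move: (col_op nu) (row_op rho) => b a; rewrite mulmx_sumr mulmx_suml; apply: eq_bigr => p _.
rewrite mulmx_sumr mulmx_suml; apply: eq_bigr => q _.
by rewrite -scalemxAr -scalemxAl.
Qed.

(** A nonzero product has a nonzero factor b_nu z a_rho and a nonzero factor a_nu y b_rho. These
    give opposite inequalities between the sums of the row indices of the two shapes, and the
    equality case identifies the shapes. *)
Lemma young_op_cross (nu rho : young d) x : nu != rho ->
  young_op nu *m rG x *m young_op rho = 0.
Proof.
move=> ne_nu; apply/eqP/negPn/negP => nz.
have [z nz_z] : exists z, col_op nu *m rG z *m row_op rho != 0.
  apply/existsP; apply: contraR nz; rewrite negb_exists => /forallP nz0.
  rewrite young_op_reprE !big1 // => p _; rewrite big1 // => q _.
  by move: (nz0 (p * x * q)%g); rewrite negbK => /eqP->; rewrite scaler0.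
have [y nz_y] : exists y, row_op nu *m rG y *m col_op rho != 0.
  exists x; apply: contraNneq nz => mid0.
  by rewrite /young_op mulmxA -[_ *m rG x]mulmxA -[_ *m col_op rho]mulmxA mid0
    mulmx0 mul0mx.
have le_nu := young_distinct_leq (col_repr_row_distinct nz_z).
(* The mirror image of [col_repr_row_eq0]: the transposition now enters from the row side and is
   absorbed by the column antisymmetrizer on the right. *)
have dist_y : forall i j : 'I_d, box_col rho i = box_col rho j ->
    box_row nu (y^-1 i)%g = box_row nu (y^-1 j)%g -> i = j.
  move=> i j eq_c eq_r; apply/eqP; apply: contraR nz_y => ne_ij.
  set i' := (y^-1)%g i in eq_r; set j' := (y^-1)%g j in eq_r.
  have [yi yj] : y i' = i /\ y j' = j by rewrite !permKV.
  set X := _ *m _; have defX : X = - X.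
    have swap : (tperm i' j' * y = y * tperm i j)%g.
      by rewrite (conjgC _ y) tpermJ yi yj.
    rewrite {1}/X -(mul_row_op_repr (row_stab_tperm eq_r)) -(mulmxA (row_op _)).
    rewrite -perm_reprM swap perm_reprM -!mulmxA mul_repr_col_op ?col_stab_tperm //.
    by rewrite odd_tperm ne_ij expr1 scaleN1r !mulmxN /X mulmxA.
  by apply/eqP; exact: eq_oppmx_eq0 defX.
have le_rho := young_distinct_leq dist_y.
by case/eqP: ne_nu; have [] := young_distinct_eq (col_repr_row_distinct nz_z) le_rho.
Qed.

End YoungOps.

(** The scalar is the sign of q if [z] factors as q p with q in the column and p in the row
    stabilizer, and 0 otherwise. It is chosen before the representation, so it can be computed in
    one and used in another. *)
Lemma col_repr_row_scalar (d : nat) (l : young d) (z : 'S_d) :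
  exists a : rat, forall n (rG : mx_representation rat [set: 'S_d]%G n),
    col_op rG l *m rG z *m row_op rG l = a *: young_op rG l.
Proof.
pose dist := [forall i : 'I_d, [forall j : 'I_d,
  (box_col l i == box_col l j) && (box_row l (z i) == box_row l (z j)) ==> (i == j)]].
case: (boolP dist) => [/forallP distP | ].
  have [_ [q [qc qr]]] : l = l /\ exists q : 'S_d,
      (forall i, box_col l (q i) = box_col l i)
      /\ (forall i, box_row l (q i) = box_row l (z i)).
    apply: young_distinct_eq => // i j eq_c eq_r; apply/eqP.
    by move/forallP: (distP i) => /(_ j); rewrite eq_c eq_r !eqxx.
  have Cq : q \in col_stab d l by apply/col_stabP.
  have Rp : (q^-1 * z)%g \in row_stab d l.
    by apply/row_stabP=> i; rewrite permM -qr permKV.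
  exists ((-1) ^+ odd_perm q) => n rG; rewrite -[z in rG z](mulKVg q) perm_reprM.
  rewrite mulmxA mul_col_op_repr // -!scalemxAl -mulmxA mul_repr_row_op //.
rewrite negb_forall => /existsP[i]; rewrite negb_forall => /existsP[j].
rewrite negb_imply => /andP[/andP[/eqP eq_c /eqP eq_r] ne_ij].
by exists 0 => n rG; rewrite scale0r (col_repr_row_eq0 _ ne_ij).
Qed.

Lemma young_op_scalar (d : nat) (l : young d) (x : 'S_d) :
  exists a : rat, forall n (rG : mx_representation rat [set: 'S_d]%G n),
    young_op rG l *m rG x *m young_op rG l = a *: young_op rG l.
Proof.
have /fin_all_exists[a aP] := col_repr_row_scalar l.
exists (\sum_(p in row_stab d l) \sum_(q in col_stab d l)
          (-1) ^+ (odd_perm q) * a (p * x * q)%g) => n rG.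
rewrite young_op_reprE scaler_suml; apply: eq_bigr => p _.
rewrite scaler_suml; apply: eq_bigr => q _.
by rewrite aP scalerA.
Qed.

Definition orthogonal_repr (d n : nat) (rG : mx_representation rat [set: 'S_d]%G n) :=
  forall x, (rG x)^T = rG x^-1%g.

Section Orthogonal.
Variables (d n : nat) (rG : mx_representation rat [set: 'S_d]%G n).
Hypothesis orthG : orthogonal_repr rG.

Lemma tr_row_op l : (row_op rG l)^T = row_op rG l.
Proof.
rewrite /row_op raddf_sum [RHS](reindex_inj invg_inj) /=.
by apply: eq_big => [x | x _]; rewrite ?groupV // orthG.
Qed.

Lemma tr_col_op l : (col_op rG l)^T = col_op rG l.
Proof.
rewrite /col_op raddf_sum [RHS](reindex_inj invg_inj) /=.
by apply: eq_big => [x | x _]; rewrite ?groupV // linearZ /= orthG odd_permV.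
Qed.

Lemma tr_young_op l : (young_op rG l)^T = row_op rG l *m col_op rG l.
Proof. by rewrite trmx_mul tr_row_op tr_col_op. Qed.

(* If (b a)(b a) = 0 then a b a, being symmetric with (a b a)(a b a) = 0,
   vanishes, hence so does (b a)^T (b a), a multiple of a b a. *)
Lemma young_op_sqr_neq0 l : young_op rG l != 0 -> young_op rG l *m young_op rG l != 0.
Proof.
set a := row_op rG l; set b := col_op rG l; rewrite /young_op -/a -/b.
apply: contraNneq => baba0.
have aa : a *m a = #|row_stab d l|%:R *: a by apply: row_op_sqr.
have bb : b *m b = #|col_stab d l|%:R *: b by apply: col_op_sqr.
have nza : #|row_stab d l|%:R != 0 :> rat by apply: card_stab_neq0.
have nzb : #|col_stab d l|%:R != 0 :> rat by apply: card_stab_neq0.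
have aba0 : a *m b *m a = 0.
  apply: mulmx_tr_eq0; rewrite !trmx_mul tr_row_op tr_col_op -/a -/b.
  rewrite -!mulmxA [a *m (a *m _)]mulmxA aa -!scalemxAl -!scalemxAr.
  by move: baba0; rewrite -!mulmxA => ->; rewrite mulmx0 scaler0.
apply/eqP/trmx_inj; rewrite trmx0; apply: mulmx_tr_eq0.
rewrite trmxK trmx_mul tr_row_op tr_col_op -/a -/b.
rewrite -!mulmxA [b *m (b *m _)]mulmxA bb -!scalemxAl -!scalemxAr.
by rewrite [a *m (b *m a)]mulmxA aba0 scaler0.
Qed.

End Orthogonal.

(** * Place permutations on tensors, in coordinates *)

Section Place.
Variables (d m : nat).
Implicit Types (t : tensor d m) (v w : word d m) (l : seq nat).

Definition word_perm (v : word d m) (x : 'S_d) : word d m := [ffun i => v (x i)].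

Definition tcoef (t : tensor d m) (v : word d m) : rat := t 0 (enum_rank v).

Lemma tcoefP s t : tcoef s =1 tcoef t -> s = t.
Proof. by move=> eq_st; apply/rowP=> b; rewrite -(enum_valK b); apply: eq_st. Qed.

Lemma tcoef0 v : tcoef 0 v = 0. Proof. exact: mxE. Qed.
Lemma tcoefD s t v : tcoef (s + t) v = tcoef s v + tcoef t v. Proof. exact: mxE. Qed.
Lemma tcoefZ a t v : tcoef (a *: t) v = a * tcoef t v. Proof. exact: mxE. Qed.

Lemma tcoef_place t x v : tcoef (t *m place_repr d m x) v = tcoef t (word_perm v x).
Proof. exact: place_mxE. Qed.

Lemma tcoef_row_op t l v :
  tcoef (t *m row_op (place_repr d m) l) v =
    \sum_(p in row_stab d l) tcoef t (word_perm v p).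
Proof.
rewrite /row_op mulmx_sumr /tcoef summxE; apply: eq_bigr => p _.
exact: tcoef_place.
Qed.

Lemma tcoef_col_op t l v :
  tcoef (t *m col_op (place_repr d m) l) v =
    \sum_(q in col_stab d l) (-1) ^+ (odd_perm q) * tcoef t (word_perm v q).
Proof.
rewrite /col_op mulmx_sumr /tcoef summxE; apply: eq_bigr => q _.
by rewrite -scalemxAr mxE; congr (_ * _); apply: tcoef_place.
Qed.

Lemma place_orthogonal : orthogonal_repr (place_repr d m).
Proof.
move=> x; apply/matrixP=> a b; rewrite !mxE; congr (nat_of_bool _)%:R.
apply/forallP/forallP => h i.
  by have := h (x^-1 i)%g; rewrite permKV eq_sym.
by have := h (x i); rewrite permK eq_sym.
Qed.

(* The coefficient at w of w c is the order of the row stabilizer, since no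
   nontrivial column permutation fixes the row indices. *)
Lemma tcoef_young_op t (l : young d) w :
    (forall i j, (w i == w j) = (box_row l i == box_row l j)) ->
  tcoef (t *m young_op (place_repr d m) l) w =
    #|row_stab d l|%:R * tcoef (t *m col_op (place_repr d m) l) w.
Proof.
move=> wP; rewrite mulmxA tcoef_row_op.
rewrite (eq_bigr (fun=> tcoef (t *m col_op (place_repr d m) l) w)).
  by rewrite sumr_const mulr_natl.
move=> p /row_stabP Rp; congr tcoef; apply/ffunP=> i; rewrite ffunE.
by apply/eqP; rewrite wP Rp.
Qed.

End Place.

(** The witness is the basis tensor of the word that labels each box by its row. Among column
    permutations only the identity fixes this word, so its coefficient in the image is the order of
    the row stabilizer. *)
Lemma young_op_place_neq0 d (l : young d) : young_op (place_repr d d) l != 0.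
Proof.
pose w : word d d := [ffun i => Ordinal (box_row_lt_size l i)].
have wE i j : (w i == w j) = (box_row l i == box_row l j) by rewrite !ffunE.
pose t : tensor d d := delta_mx 0 (enum_rank w).
apply: contraTneq isT => c0.
have := tcoef_young_op t wE; rewrite c0 mulmx0 tcoef0 tcoef_col_op.
rewrite (bigD1 1%g) ?group1 //= big1 => [|q /andP[/col_stabP Cq ne_q]].
  rewrite addr0 odd_perm1 mul1r (_ : word_perm _ _ = w).
    rewrite /tcoef mxE !eqxx mulr1 => /esym/eqP.
    by rewrite (negPf (card_stab_neq0 _)).
  by apply/ffunP=> i; rewrite ffunE perm1.
rewrite /tcoef mxE eqxx /= (inj_eq enum_rank_inj).
case: eqP => [eq_w | _]; last by rewrite mulr0.
case/eqP: ne_q; apply/permP=> i; rewrite perm1; apply: (@box_inj _ l) => //.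
by apply/eqP; rewrite -wE; move/ffunP/(_ i): eq_w; rewrite [LHS]ffunE => ->.
Qed.

(** The scalar of [young_op_scalar] at 1 is the same in all representations, and place permutations
    on the d-th tensor power of [rat^d] show that it is not 0. *)
Lemma young_op_sqr d (l : young d) : exists2 a : rat, a != 0 &
  forall n (rG : mx_representation rat [set: 'S_d]%G n),
    young_op rG l *m young_op rG l = a *: young_op rG l.
Proof.
have [a aP] := young_op_scalar l 1%g; exists a; last first.
  by move=> n rG; rewrite -aP repr_mx1 mulmx1.
have := young_op_sqr_neq0 (@place_orthogonal d d) (young_op_place_neq0 l).
apply: contraNneq => a0.
by have := aP _ (place_repr d d); rewrite repr_mx1 mulmx1 a0 scale0r => ->.
Qed.

(** * Modules generated by the image of a Young symmetrizer *)

Section Cyclic.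
Variables (d n : nat) (rG : mx_representation rat [set: 'S_d]%G n).
Hypothesis orthG : orthogonal_repr rG.
Implicit Types (t u : 'rV[rat]_n) (l : young d).

Lemma cyclic_sumP t u : (u <= cyclic_mx rG t)%MS ->
  exists a : 'S_d -> rat, u = \sum_x a x *: (t *m rG x).
Proof.
case/cyclic_mxP=> A /envelop_mxP[a ->] ->; exists a.
rewrite mulmx_sumr; apply: eq_big => [x|x _]; first by rewrite inE.
by rewrite scalemxAr.
Qed.

(** Up to a nonzero scalar the transpose a b of c equals its square a (b a) b = a c b, and [u x a c]
    is a sum of terms [u y c]. *)
Lemma young_op_tr_eq0 l u :
    (forall x, u *m rG x *m young_op rG l = 0) ->
  forall x, u *m rG x *m (young_op rG l)^T = 0.
Proof.
move=> uc0 x; have [a nz_a aP] := young_op_sqr l.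
have sq : (young_op rG l)^T *m (young_op rG l)^T = a *: (young_op rG l)^T.
  by rewrite -trmx_mul aP linearZ.
apply: (scalerI nz_a); rewrite scaler0 scalemxAr -sq tr_young_op //.
have mid0 : u *m rG x *m row_op rG l *m young_op rG l = 0.
  rewrite -(mulmxA u) {1}/row_op 2!mulmx_sumr mulmx_suml big1 // => p _.
  by rewrite -perm_reprM uc0.
by rewrite /young_op !mulmxA in mid0 *; rewrite mid0 mul0mx.
Qed.

(** As c z c = K(z) c, each [u x c] is a multiple of [t c]. If all of them vanished, [u] would be
    orthogonal to every [t c z], hence to the module that contains it and to itself. *)
Lemma young_cyclic_detect l t u :
    (u <= cyclic_mx rG (t *m young_op rG l))%MS -> u != 0 ->
  exists x a, a != 0 /\ u *m rG x *m young_op rG l = a *: (t *m young_op rG l).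
Proof.
move=> /cyclic_sumP[al defu] nz_u.
have /fin_all_exists[K KP] := young_op_scalar l.
have ucE x : u *m rG x *m young_op rG l
             = (\sum_z al z * K (z * x)%g) *: (t *m young_op rG l).
  rewrite defu !mulmx_suml scaler_suml; apply: eq_bigr => z _.
  rewrite -!scalemxAl -scalerA; congr (_ *: _).
  by rewrite scalemxAr -KP perm_reprM !mulmxA.
have [/existsP[x nz_x] | ] := boolP [exists x, u *m rG x *m young_op rG l != 0].
  exists x, (\sum_z al z * K (z * x)%g); split; last exact: ucE.
  by apply: contraNneq nz_x => K0; rewrite ucE K0 scale0r.
rewrite negb_exists => /forallP uc0.
have {}uc0 x : u *m rG x *m young_op rG l = 0 by apply/eqP; rewrite -[_ == _]negbK uc0.
case/eqP: nz_u; apply/eqP; rewrite -dotvv_eq0; apply/eqP.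
rewrite {2}defu raddf_sum /= mulmx_sumr summxE big1 // => z _.
rewrite linearZ /= -scalemxAr trmx_mul orthG trmx_mul !mulmxA young_op_tr_eq0 //.
by rewrite mul0mx scaler0 mxE.
Qed.

(** A nonzero vector of a submodule is mapped by some [x c] to a nonzero multiple of the generator,
    so the submodule is everything. *)
Lemma young_cyclic_simple l t : t *m young_op rG l != 0 ->
  mxsimple rG (cyclic_mx rG (t *m young_op rG l)).
Proof.
move=> nz_t; split; rewrite ?cyclic_mx_module ?cyclic_mx_eq0 // => V modV sVU nzV.
have [i nz_i] : exists i, row i V != 0.
  apply/existsP; apply: contraR nzV; rewrite negb_exists => /forallP V0.
  by apply/eqP/row_matrixP=> i; rewrite row0; apply/eqP; rewrite -[_ == _]negbK V0.
have [x [a [nz_a tcE]]] := young_cyclic_detect (submx_trans (row_sub i V) sVU) nz_i.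
apply: cyclic_mx_sub => //; rewrite -(eqmx_scale _ nz_a) -tcE.
have sub_x : (row i V *m rG x <= V)%MS.
  by rewrite (mxmodule_trans modV) ?row_sub ?inE.
have mulV (y : 'S_d) : (row i V *m rG x *m rG y <= V)%MS.
  by rewrite (mxmodule_trans modV) ?inE.
rewrite /young_op mulmxA /row_op mulmx_sumr summx_sub // => p _.
apply: mxmodule_trans => //; rewrite ?inE //.
rewrite /col_op mulmx_sumr summx_sub // => q _.
by rewrite -scalemxAr scalemx_sub.
Qed.

Lemma young_cyclic_orthogonal (l l' : young d) t t' u u' : l != l' ->
    (u <= cyclic_mx rG (t *m young_op rG l))%MS ->
    (u' <= cyclic_mx rG (t' *m young_op rG l'))%MS ->
  u *m u'^T = 0.
Proof.
move=> ne_l /cyclic_sumP[a defu] /cyclic_sumP[a' ->].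
have uc0 x : u *m rG x *m young_op rG l' = 0.
  rewrite defu !mulmx_suml big1 // => z _.
  have cross0 : young_op rG l *m rG z *m rG x *m young_op rG l' = 0.
    by rewrite -(mulmxA _ (rG z)) -perm_reprM young_op_cross.
  by rewrite -!scalemxAl -!(mulmxA t) cross0 mulmx0 scaler0.
rewrite raddf_sum /= mulmx_sumr big1 // => z _.
rewrite linearZ /= -scalemxAr trmx_mul orthG trmx_mul !mulmxA young_op_tr_eq0 //.
by rewrite mul0mx scaler0.
Qed.

End Cyclic.

(** * Completeness of the Young symmetrizers *)

Section Peeling.
Variables (d n : nat) (rG : mx_representation rat [set: 'S_d]%G n).
Variables (l : young d) (w : 'rV[rat]_n).
Hypothesis w_row : forall p, p \in row_stab d l -> w *m rG p = w.
Hypothesis w_raise : forall (y : 'I_d) r, (r < box_row l y)%N ->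
  \sum_(i : 'I_d | box_row l i == r) w *m rG (tperm i y) = - w.

(** Interpolates between the identity, for empty [T], and [col_op], for the set of all boxes. *)
Definition col_op_on (T : {set 'I_d}) : 'M[rat]_n :=
  \sum_(q in col_stab d l | perm_on T q) (-1) ^+ (odd_perm q) *: rG q.

(** The column permutations supported on [i |: T] are sorted by the preimage s of i; each class is
    the transposition of i and s times the column permutations supported on [T]. *)
Lemma col_op_onD1 (T : {set 'I_d}) (i : 'I_d) : i \notin T ->
  col_op_on (i |: T) =
    col_op_on T
    - \sum_(s in T | box_col l s == box_col l i) rG (tperm i s) *m col_op_on T.
Proof.
move=> T'i; pose F (q : 'S_d) := (-1) ^+ (odd_perm q) *: rG q.
pose P (q : 'S_d) := (q \in col_stab d l) && perm_on (i |: T) q.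
have fiber (s : 'I_d) : s \in i |: T -> box_col l s = box_col l i ->
    \sum_(q | P q && ((q^-1)%g i == s)) F q
      = (-1) ^+ (i != s) *: (rG (tperm i s) *m col_op_on T).
  move=> Ts cs; rewrite (reindex_inj (mulgI (tperm i s))) /= /col_op_on.
  rewrite mulmx_sumr scaler_sumr; apply: eq_big => [q | q _]; last first.
    rewrite /F odd_permM odd_tperm signr_addb -scalemxAr scalerA.
    by rewrite repr_mxM ?inE.
  have tC : tperm i s \in col_stab d l by apply: col_stab_tperm.
  rewrite /P groupMl // -andbA; congr (_ && _).
  rewrite invMg tpermV permM.
  have -> : (tperm i s ((q^-1)%g i) == s) = (q i == i).
    rewrite -{2}(tpermL i s) (inj_eq perm_inj) -(inj_eq (@perm_inj _ q)) permKV.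
    by rewrite eq_sym.
  have on_t : perm_on (i |: T) (tperm i s).
    apply/subsetP=> x; rewrite inE; case: tpermP => [->|->|]; rewrite ?Ts ?setU11 //.
    by rewrite eqxx.
  apply/andP/idP => [[onq /eqP qi] | onq].
    apply/subsetP=> x; rewrite inE => nx.
    have ne_xi : x != i by apply: contraNneq nx => ->; rewrite qi.
    have onq' : perm_on (i |: T) q.
      by rewrite -[q](mulKg (tperm i s)) tpermV perm_onM.
    by move/subsetP/(_ x): onq'; rewrite !inE nx (negPf ne_xi) => /(_ isT).
  have qi : q i = i by apply: (out_perm onq).
  rewrite qi eqxx; split=> //; apply: perm_onM => //.
  by apply: subset_trans onq (subsetUr _ _).
rewrite {1}/col_op_on (partition_big (fun q : 'S_d => (q^-1)%g i)
  (fun s => (s \in i |: T) && (box_col l s == box_col l i))) /=; last first.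
  move=> q /andP[/col_stabP Cq onq]; apply/andP; split.
    by rewrite -(perm_closed _ onq) permKV setU11.
  by rewrite -Cq permKV.
rewrite (bigD1 i) ?setU11 ?eqxx //= (fiber i) ?setU11 //.
rewrite eqxx tperm1 repr_mx1 mul1mx scale1r; congr (_ + _).
rewrite -sumrN; apply: eq_big => [s | s /andP[/andP[Ts /eqP cs] ne_s]].
  by rewrite !inE; case: eqP => [->|_]; rewrite ?(negPf T'i) ?andbF ?andbT.
by rewrite (fiber s) // eq_sym ne_s expr1 scaleN1r.
Qed.

Lemma commute_col_op_on (T : {set 'I_d}) (i r : 'I_d) : i \notin T -> r \notin T ->
  rG (tperm i r) *m col_op_on T = col_op_on T *m rG (tperm i r).
Proof.
move=> T'i T'r; rewrite /col_op_on mulmx_sumr mulmx_suml; apply: eq_bigr => q /andP[_ onq].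
rewrite -scalemxAr -scalemxAl -!repr_mxM ?inE //; congr (_ *: rG _).
by rewrite conjgC tpermJ !(out_perm onq).
Qed.

Lemma mul_tperm_col_op_on (T : {set 'I_d}) (r x : 'I_d) :
    r \in T -> x \in T -> r != x -> box_col l r = box_col l x ->
  rG (tperm r x) *m col_op_on T = - col_op_on T.
Proof.
move=> Tr Tx ne_rx c_rx; have Ct := col_stab_tperm c_rx.
have on_t : perm_on T (tperm r x).
  apply/subsetP=> y; rewrite inE; case: tpermP => [->|->|] //.
  by rewrite eqxx.
rewrite /col_op_on mulmx_sumr -sumrN [RHS](reindex_inj (mulgI (tperm r x))) /=.
apply: eq_big => [q | q _].
  rewrite groupMl //; congr (_ && _); apply/idP/idP => [|onq]; first exact: perm_onM.
  by rewrite -[q](mulKg (tperm r x)) tpermV perm_onM.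
rewrite -scalemxAr -repr_mxM ?inE // odd_permM odd_tperm ne_rx.
by rewrite signr_addb mulN1r scaleNr opprK.
Qed.

(* Summing [w (1 - \sum_s (r s)) b_T], where s runs over the boxes of T in the
   column of i, over the boxes r of the row of i that are not left of i gives a
   positive multiple of [w b_T]: the raising relation evaluates the sum over the
   whole row, and the boxes r left of i contribute [w (r s) b_T = 0]. *)
Lemma col_op_on_step (T : {set 'I_d}) (i : 'I_d) :
    (forall s, (s \in T) = (box_col l s < box_col l i)%N
       || (box_col l s == box_col l i) && (box_row l i < box_row l s)%N) ->
  w *m col_op_on (i |: T) = 0 -> w *m col_op_on T = 0.
Proof.
move=> defT; have T'i : i \notin T by rewrite defT !ltnn andbF.
rewrite col_op_onD1 //; move defB: (col_op_on T) => B.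
pose Q (s : 'I_d) := (s \in T) && (box_col l s == box_col l i).
pose R' (r : 'I_d) := (box_row l r == box_row l i) && (box_col l i <= box_col l r)%N.
have T'R r : R' r -> r \notin T.
  by case/andP=> /eqP rr cr; rewrite defT rr ltnn andbF orbF -leqNgt.
rewrite mulmxBr mulmx_sumr => step0.
(* Multiplication by the transposition of i and r transports the relation from i to r: it fixes [w]
   and commutes with [B]. *)
have D0 r : R' r -> w *m B = \sum_(s | Q s) w *m rG (tperm r s) *m B.
  move=> Rr; have T'r := T'R r Rr; have [/eqP rr _] := andP Rr.
  have wt : w *m rG (tperm i r) = w by rewrite w_row ?row_stab_tperm.
  have BE := commute_col_op_on T'i T'r; rewrite defB in BE.
  move/eqP: step0; rewrite subr_eq0 => /eqP/(congr1 (mulmx^~ (rG (tperm i r)))).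
  rewrite /= -(mulmxA w) -BE mulmxA wt => ->; rewrite mulmx_suml; apply: eq_bigr => s /andP[Ts _].
  have ne_si : s != i by apply: contraNneq T'i => <-.
  have ne_sr : s != r by apply: contraNneq T'r => <-.
  have -> : tperm r s = (tperm i r * tperm i s * tperm i r)%g.
    rewrite -{1}(tpermV i r) -mulgA -conjgE tpermJ tpermL tpermD // eq_sym //.
  by rewrite !repr_mxM ?inE // !mulmxA wt -!mulmxA BE.
have sumR s : Q s -> \sum_(r | R' r) w *m rG (tperm r s) *m B = - (w *m B).
  case/andP=> Ts /eqP cs; have lt_r : (box_row l i < box_row l s)%N.
    by move: Ts; rewrite defT cs ltnn eqxx.
  rewrite -mulNmx -(w_raise lt_r) mulmx_suml.
  rewrite [RHS](bigID (fun r : 'I_d => box_col l i <= box_col l r)%N) /=.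
  rewrite [X in _ = _ + X]big1 ?addr0 // => r /andP[/eqP rr]; rewrite -ltnNge => cr.
  (* The transposition of r and x changes the sign of [B] but fixes [w (r s)], because it becomes
     the row transposition of s and x; so the term at r is its own negative. *)
  have [x [rx cx]] : exists x : 'I_d, box_row l x = box_row l s /\ box_col l x = box_col l r.
    by apply: box_left; rewrite cs ltnW.
  have Tr : r \in T by rewrite defT cr.
  have Tx : x \in T by rewrite defT cx cr.
  have ne_rx : r != x by apply: contraTneq lt_r => e; rewrite -rx -e rr ltnn.
  have ne_sx : x != s by apply: contraTneq cr => e; rewrite -cx e cs ltnn.
  have wE : w *m rG (tperm r s) *m rG (tperm r x) = w *m rG (tperm r s).
    rewrite -mulmxA -repr_mxM ?inE //.
    have -> : (tperm r s * tperm r x = tperm s x * tperm r s)%g.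
      by rewrite (conjgC (tperm s x)) tpermJ tpermR tpermD // eq_sym.
    by rewrite repr_mxM ?inE // mulmxA (w_row (row_stab_tperm (esym rx))).
  apply: eq_oppmx_eq0; rewrite -mulmxN -{2}defB.
  by rewrite -(mul_tperm_col_op_on Tr Tx ne_rx) // defB mulmxA wE.
(* Summing [D0] over r and exchanging the sums gives (#|R'| + #|Q|) w B = 0, where R' contains i. *)
have : \sum_(r | R' r) w *m B = - (\sum_(s | Q s) w *m B).
  rewrite -sumrN (eq_bigr _ D0) exchange_big /=; apply: eq_bigr => s; exact: sumR.
rewrite !sumr_const => /eqP; rewrite -addr_eq0 -mulrnDr -scaler_nat scaler_eq0 pnatr_eq0.
case/orP=> [|/eqP//]; rewrite addn_eq0 => /andP[/eqP/card0_eq/(_ i)].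
by rewrite unfold_in /R' /= eqxx leqnn.
Qed.

Lemma col_op_eq0_raise : w *m col_op rG l = 0 -> w = 0.
Proof.
(* Boxes are ordered by columns from left to right, and from bottom to top in each column, so that
   the boxes before i form the set required by [col_op_on_step]. *)
pose key (i : 'I_d) := (box_col l i * d + (d.-1 - box_row l i))%N.
have key_ltn i j : (key j < key i)%N = (box_col l j < box_col l i)%N
       || (box_col l j == box_col l i) && (box_row l i < box_row l j)%N.
  have := box_row_lt_size l i; have := box_row_lt_size l j; rewrite /key.
  move=> lt_j lt_i; case: (ltngtP (box_col l j)) => [lt_c | lt_c | ->] /=; last by lia.
    by have := leq_mul lt_c (leqnn d); rewrite mulSn; lia.
  by have := leq_mul lt_c (leqnn d); rewrite mulSn; lia.
pose T k := [set i | key i < k]%N.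
have T0 : T 0%N = set0 by apply/setP=> i; rewrite !inE.
have TT : T (d * d).+1 = setT.
  apply/setP=> i; rewrite !inE /key ltnS.
  have := box_row_lt_size l i; have := box_col_lt_size l i; nia.
have -> : col_op rG l = col_op_on (T (d * d).+1).
  rewrite TT; apply: eq_bigl => q; apply/esym/andb_idr => _.
  by apply/subsetP=> x _; rewrite inE.
elim: (d * d).+1 => [|k IHk].
  rewrite T0 /col_op_on (big_pred1 1%g) => [|q].
    by rewrite odd_perm1 scale1r repr_mx1 mulmx1.
  apply/andP/eqP => [[_ onq] | ->]; last by rewrite group1 perm_on1.
  by apply/permP=> i; rewrite perm1 (out_perm onq) ?inE.
have [/existsP[i /eqP ki] | ] := boolP [exists i, key i == k]; last first.
  rewrite negb_exists => /forallP ne_k; rewrite (_ : T k.+1 = T k) //.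
  by apply/setP=> i; rewrite !inE ltnS leq_eqVlt (negPf (ne_k i)).
have -> : T k.+1 = i |: T k.
  apply/setP=> j; rewrite !inE ltnS leq_eqVlt; congr (_ || _).
  apply/eqP/eqP => [kj | -> //].
  have := key_ltn i j; have := key_ltn j i; rewrite ki kj ltnn.
  case: (ltngtP (box_col l i) (box_col l j)) => //= eq_c.
  by case: ltngtP => // eq_r _ _; apply: (@box_inj _ l).
by move/col_op_on_step/IHk; apply=> s; rewrite inE -ki key_ltn.
Qed.

End Peeling.

(** The class sizes in decreasing order are the rows of [l], and [z] lists the members of the
    classes one class after the other. *)
Lemma young_of_coloring (d : nat) (f : 'I_d -> nat) :
  exists (l : young d) (z : 'S_d),
    forall i j, (f (z i) == f (z j)) = (box_row l i == box_row l j).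
Proof.
pose cls c := [seq i <- enum 'I_d | f i == c].
have cls_uniq c : uniq (cls c) by apply: filter_uniq (enum_uniq _).
have mem_cls c i : (i \in cls c) = (f i == c) by rewrite mem_filter mem_enum andbT.
pose leT a b := (size (cls b) <= size (cls a))%N.
pose cs := sort leT (undup (codom f)).
have cs_uniq : uniq cs by rewrite sort_uniq undup_uniq.
have mem_cs c : (c \in cs) = (c \in codom f) by rewrite mem_sort mem_undup.
pose ss := [seq cls c | c <- cs].
have mem_ss i : i \in flatten ss.
  apply/flatten_mapP; exists (f i); rewrite ?mem_cls //.
  by rewrite mem_cs codom_f.
have ss_uniq : uniq (flatten ss).
  rewrite /ss; move: cs_uniq; elim: (cs) => //= c s IHs /andP[s'c us].
  rewrite cat_uniq cls_uniq IHs // andbT; apply/hasPn=> i /flatten_mapP[c' s_c'].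
  rewrite !mem_cls => /eqP fi; rewrite fi; apply: contraNneq s'c => <- //.
have size_ss : size (flatten ss) = d.
  by rewrite -(card_uniqP ss_uniq) -[RHS]card_ord; apply: eq_card => i; rewrite mem_ss inE.
have lP : is_young d (shape ss).
  apply/and3P; split.
  - rewrite /shape -map_comp sorted_map.
    have tot : total leT by move=> a b; apply: leq_total.
    exact: (sort_sorted tot).
  - apply/mapP=> -[s /mapP[c]]; rewrite mem_cs => /codomP[i ->] -> /esym/size0nil c0.
    by have := mem_cls (f i) i; rewrite c0 eqxx.
  - by rewrite -size_flatten size_ss.
pose l := Young lP.
have z_lt (i : 'I_d) : (i < size (flatten ss))%N by rewrite size_ss.
have z_inj : injective (fun i : 'I_d => nth i (flatten ss) i).
  move=> i j /eqP; rewrite (set_nth_default j) // nth_uniq //.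
  by move/eqP/val_inj.
exists l, (perm z_inj) => i j.
have fz (h : 'I_d) : f (perm z_inj h) = nth 0%N cs (box_row l h).
  rewrite permE nth_flatten -/(shape ss).
  have := box_row_lt l h; have := box_col_lt l h; rewrite /= size_map => lt_c lt_r.
  move: lt_c; rewrite (nth_map [::]) // => lt_c.
  rewrite size_map in lt_r.
  have := mem_nth h lt_c; rewrite {2}(nth_map 0%N) // mem_cls => /eqP <-.
  by [].
have lt_cs (h : 'I_d) : (box_row l h < size cs)%N.
  by have := box_row_lt l h; rewrite /= !size_map.
by rewrite !fz nth_uniq.
Qed.

(** The sum of the squares of the class sizes, as a count of ordered pairs. *)
Definition same_color (d : nat) (f : 'I_d -> nat) : nat :=
  \sum_i \sum_j (f i == f j).

Lemma same_color_perm (d : nat) (f : 'I_d -> nat) (z : 'S_d) :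
  same_color (fun i => f (z i)) = same_color f.
Proof.
rewrite /same_color [RHS](reindex_inj (@perm_inj _ z)); apply: eq_bigr => i _.
by rewrite [RHS](reindex_inj (@perm_inj _ z)).
Qed.

(** Isolates the contribution of [y], the only box whose color changes when it is raised. *)
Lemma same_colorD1 (d : nat) (f : 'I_d -> nat) (y : 'I_d) :
  same_color f = (1 + 2 * #|[pred i | (i != y) && (f i == f y)]|
                  + \sum_(i | i != y) \sum_(j | j != y) (f i == f j))%N.
Proof.
have cardE' : #|[pred i | (i != y) && (f i == f y)]| = (\sum_(i | i != y) (f i == f y))%N.
  by rewrite -sum1_card big_mkcondr.
rewrite /same_color (bigD1 y) //= (bigD1 y) //= eqxx.
have -> : (\sum_(i | i != y) \sum_j (f i == f j) =
  \sum_(i | i != y) (f i == f y) + \sum_(i | i != y) \sum_(j | j != y) (f i == f j))%N.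
  by rewrite -big_split; apply: eq_bigr => i _; rewrite (bigD1 y).
rewrite cardE' (eq_bigr (fun i => nat_of_bool (f i == f y))) => [|i _]; last by rewrite eq_sym.
by rewrite mul2n -addnn !addnA.
Qed.

Section Complete.
Variables (d n : nat) (rG : mx_representation rat [set: 'S_d]%G n).
Hypothesis orthG : orthogonal_repr rG.

Definition young_null (u : 'rV[rat]_n) :=
  forall (l : young d) x, u *m rG x *m young_op rG l = 0.

Lemma young_null_repr u x : young_null u -> young_null (u *m rG x).
Proof. by move=> u0 l y; rewrite -(mulmxA u) -repr_mxM ?inE ?u0. Qed.

Lemma young_null_sum (I : finType) (P : pred I) (F : I -> 'rV[rat]_n) :
  (forall i, P i -> young_null (F i)) -> young_null (\sum_(i | P i) F i).
Proof.
by move=> F0 l x; rewrite !mulmx_suml big1 // => i Pi; apply: F0.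
Qed.

(* Induction on the number of pairs of boxes in a common row, which the raising
   operators increase. *)
Lemma young_null_row_stab (l : young d) (w : 'rV[rat]_n) :
  young_null w -> (forall p, p \in row_stab d l -> w *m rG p = w) -> w = 0.
Proof.
pose sc (l : young d) := same_color (fun i : 'I_d => box_row l i).
have sc_max l' : (sc l' <= d * d)%N.
  rewrite /sc /same_color; apply: (@leq_trans (\sum_(i < d) \sum_(j < d) 1)%N).
    by apply: leq_sum => i _; apply: leq_sum => j _; apply: leq_b1.
  by rewrite !sum_nat_const !card_ord muln1.
have [N leN] := ubnP (d * d - sc l).
elim: N => // N IHN in l leN w * => w0 w_row.
have IH (m : young d) u : (sc l < sc m)%N -> young_null u ->
    (forall p, p \in row_stab d m -> u *m rG p = u) -> u = 0.
  by move=> lt_sc; apply: IHN; have := sc_max m; lia.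
apply: (col_op_eq0_raise w_row) => [y r lt_r | ]; last first.
  (* As [w] is fixed by the row stabilizer, w a b is a nonzero multiple of w b. *)
  have := young_op_tr_eq0 orthG (w0 l) 1%g; rewrite repr_mx1 mulmx1 tr_young_op //.
  have -> : w *m (row_op rG l *m col_op rG l) = #|row_stab d l|%:R *: (w *m col_op rG l).
    rewrite mulmxA scalemxAl; congr (_ *m _).
    by rewrite mulmx_sumr (eq_bigr (fun=> w)) // sumr_const scaler_nat.
  move/eqP; rewrite scaler_eq0.
  by rewrite (negPf (card_stab_neq0 _)) => /eqP.
(* The coloring by rows after [y] has been raised into row r. The sum [u] below is fixed by all
   permutations preserving it, so the induction hypothesis will give [u = 0]. *)
pose f (i : 'I_d) := if i == y then r else box_row l i.
have fy : f y = r by rewrite /f eqxx.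
have f_ne i : i != y -> f i = box_row l i by rewrite /f => /negPf->.
pose u := \sum_(i | f i == r) w *m rG (tperm i y).
have u_stab (x : 'S_d) : (forall i, f (x i) = f i) -> u *m rG x = u.
  move=> xf; rewrite /u mulmx_suml [RHS](reindex_inj (@perm_inj _ x)).
  apply: eq_big => [i | i /eqP fi]; first by rewrite xf.
  rewrite -mulmxA -repr_mxM ?inE //.
  (* This permutation fixes y and preserves [f], hence preserves the rows of [l] and fixes [w]. *)
  pose s := (tperm i y * x * tperm (x i) y)%g.
  have sy : s y = y by rewrite /s !permM tpermR tpermL.
  have sf j : f (s j) = f j.
    rewrite /s !permM.
    have tf h j' : f h = r -> f (tperm h y j') = f j'.
      by move=> fh; case: tpermP => // ->; rewrite fy fh.
    by rewrite tf ?xf ?tf // xf.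
  have Rs : s \in row_stab d l.
    apply/row_stabP=> j; have [-> | ne_j] := eqVneq j y; first by rewrite sy.
    by rewrite -!f_ne ?sf // -{1}sy (inj_eq perm_inj).
  have -> : (tperm i y * x = s * tperm (x i) y)%g by rewrite /s -mulgA tperm2 mulg1.
  by rewrite repr_mxM ?inE // mulmxA (w_row _ Rs).
have u_null : young_null u by apply: young_null_sum => i _; apply: young_null_repr.
have [m [z mP]] := young_of_coloring f.
have lt_sc : (sc l < sc m)%N.
  have -> : sc m = same_color f.
    rewrite -(same_color_perm f z); apply: eq_bigr => i _; apply: eq_bigr => j _.
    by rewrite mP.
  rewrite /sc (same_colorD1 _ y) (same_colorD1 f y).
  have -> : (\sum_(i | i != y) \sum_(j | j != y) (f i == f j) =
    \sum_(i < d | i != y) \sum_(j < d | j != y) (box_row l i == box_row l j))%N.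
    by apply: eq_bigr => i ne_i; apply: eq_bigr => j ne_j; rewrite !f_ne.
  rewrite ltn_add2r ltn_add2l ltn_pmul2l //.
  have -> : #|[pred i | (i != y) && (f i == f y)]| = nth 0%N l r.
    rewrite -card_box_row; apply: eq_card => i; rewrite !inE fy.
    have [-> | ne_i] := eqVneq i y; first by rewrite /= gtn_eqF.
    by rewrite f_ne.
  apply: (@leq_trans (nth 0%N l (box_row l y))); last exact: young_nth_leq (ltnW lt_r).
  rewrite -card_box_row; apply/proper_card/properP; split.
    by apply/subsetP=> i; rewrite !inE => /andP[].
  by exists y; rewrite !inE eqxx.
have u0 : u = 0.
  (* Translation by [z] turns the stabilizer of the coloring [f] into the row stabilizer of [m]. *)
  suff uz0 : u *m rG z^-1%g = 0.
    by rewrite -[u]mulmx1 -(repr_mx1 rG) -(mulVg z) repr_mxM ?inE // mulmxA uz0 mul0mx.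
  apply: (IH m _ lt_sc); first exact: young_null_repr.
  move=> p /row_stabP pR; rewrite -mulmxA -repr_mxM ?inE //.
  have -> : (z^-1 * p = (z^-1 * p * z) * z^-1)%g by rewrite mulgK.
  rewrite repr_mxM ?inE // mulmxA (u_stab (z^-1 * p * z)%g) // => i; rewrite !permM.
  by rewrite -[X in _ = f X](permKV z); apply/eqP; rewrite mP pR.
(* The term of [u] at i = y is [w] itself; the others form the sum over row r. *)
apply/eqP; rewrite -addr_eq0 addrC; apply/eqP; rewrite -[RHS]u0 /u.
rewrite [RHS](bigD1 y) ?fy //= tperm1 repr_mx1 mulmx1; congr (_ + _).
apply: eq_bigl => i; have [-> | ne_i] := eqVneq i y; first by rewrite andbF gtn_eqF.
by rewrite f_ne // andbT.
Qed.

(** The diagram of the coloring with all colors distinct is a single column, whose row stabilizer is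
    trivial. *)
Lemma young_null_eq0 u : young_null u -> u = 0.
Proof.
have [l [z lP]] := young_of_coloring (fun i : 'I_d => nat_of_ord i).
move=> u0; apply: (@young_null_row_stab l) => // p /row_stabP pR.
suff -> : p = 1%g by rewrite repr_mx1 mulmx1.
apply/permP=> i; rewrite perm1; apply: (@perm_inj _ z); apply: val_inj.
by apply/eqP; rewrite lP pR.
Qed.

End Complete.

(** * Symplectic invariants *)

Section Symplectic.
Variable g : nat.
Local Notation J := (symp_mx g).

Lemma symp_mxll (a b : 'I_g) : J (lshift g a) (lshift g b) = 0.
Proof. by rewrite block_mxEul mxE. Qed.

Lemma symp_mxlr (a b : 'I_g) : J (lshift g a) (rshift g b) = (a == b)%:R.
Proof. by rewrite block_mxEur mxE. Qed.

Lemma symp_mxrl (a b : 'I_g) : J (rshift g a) (lshift g b) = - (a == b)%:R.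
Proof. by rewrite block_mxEdl !mxE. Qed.

Lemma symp_mxrr (a b : 'I_g) : J (rshift g a) (rshift g b) = 0.
Proof. by rewrite block_mxEdr mxE. Qed.

Lemma symp_mx_tr : J^T = - J.
Proof. by rewrite /symp_mx tr_block_mx opp_block_mx !linear0 linearN /= trmx1 opprK. Qed.

Lemma symp_mx_sqr : J *m J = - 1%:M.
Proof.
rewrite /symp_mx mulmx_block !mul0mx !mulmx0 !mulNmx !mulmxN !mul1mx !addr0 !add0r.
by rewrite [in RHS]scalar_mx_block opp_block_mx !oppr0.
Qed.

Lemma in_SpP (A : 'M[rat]_(g + g)) : in_Sp A <-> A *m J *m A^T = J.
Proof.
split=> [[_ Amu] | AJ].
  apply/matrixP=> i j; have := Amu (delta_mx 0 i) (delta_mx 0 j).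
  have entry (M : 'M[rat]_(g + g)) :
      ((delta_mx 0 i : 'rV_(g + g)) *m M *m (delta_mx 0 j : 'rV_(g + g))^T) 0 0
      = M i j.
    by rewrite trmx_delta -rowE -colE !mxE.
  by rewrite /mu trmx_mul -entry -[J i j]entry !mulmxA.
split=> [|u v].
  have /mulmx1_unit[] // : A *m (- (J *m A^T *m J)) = 1%:M.
  by rewrite mulmxN !mulmxA AJ symp_mx_sqr opprK.
by rewrite /mu trmx_mul !mulmxA -(mulmxA u) -(mulmxA u) AJ.
Qed.

(** A right inverse of a square matrix is a left inverse: [A (- J A^T J) = 1], read in the other
    order, gives the condition for [A^T]. *)
Lemma in_Sp_tr (A : 'M[rat]_(g + g)) : in_Sp A -> in_Sp A^T.
Proof.
move=> /in_SpP AJ; apply/in_SpP; rewrite trmxK.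
have : A *m (- (J *m A^T *m J)) = 1%:M by rewrite mulmxN !mulmxA AJ symp_mx_sqr opprK.
move/mulmx1C/(congr1 (mulmx J)); rewrite mulmx1 mulNmx mulmxN !mulmxA symp_mx_sqr.
by rewrite !mulNmx opprK mul1mx.
Qed.

Lemma in_Sp_symp : @in_Sp g J.
Proof. by apply/in_SpP; rewrite symp_mx_sqr symp_mx_tr mulmxN mulNmx mul1mx opprK. Qed.

End Symplectic.

Section TensorPower.
Variables (n m : nat).
Implicit Types (A B : 'M[rat]_m) (t : tensor n m).

Lemma mulmx_pureP (p : nat) (M M' : 'M[rat]_(#|{: word n m}|, p)) :
  (forall u : 'I_n -> 'rV[rat]_m, pure u *m M = pure u *m M') -> M = M'.
Proof.
move=> eqM; apply/row_matrixP=> a; rewrite !rowE -(enum_valK a) -pure_delta.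
exact: eqM.
Qed.

Lemma eq_pure (u u' : 'I_n -> 'rV[rat]_m) : u =1 u' -> pure u = pure u'.
Proof.
by move=> eq_u; apply/rowP=> a; rewrite !mxE; apply: eq_bigr => i _; rewrite eq_u.
Qed.

Lemma tensor_mxM A B : tensor_mx n (A *m B) = tensor_mx n A *m tensor_mx n B.
Proof.
apply: mulmx_pureP => u; rewrite mulmxA !pure_tensor_mx.
by apply: eq_pure => i; rewrite mulmxA.
Qed.

Lemma tensor_mx_place A x :
  tensor_mx n A *m place_repr n m x = place_repr n m x *m tensor_mx n A.
Proof.
apply: mulmx_pureP => u; rewrite !mulmxA pure_tensor_mx.
pose v i := u (x^-1 i)%g.
have defu : pure u = pure (fun i => v (x i)) by apply: eq_pure => i; rewrite /v permK.
rewrite defu /= pure_place_mx pure_tensor_mx.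
rewrite -(pure_place_mx x (fun i => v i *m A)); congr (_ *m _).
by apply: eq_pure => i; rewrite /v permK.
Qed.

Lemma tensor_mx_col_op A l :
  tensor_mx n A *m col_op (place_repr n m) l = col_op (place_repr n m) l *m tensor_mx n A.
Proof.
rewrite /col_op mulmx_sumr mulmx_suml; apply: eq_bigr => q _.
by rewrite -scalemxAr -scalemxAl tensor_mx_place.
Qed.

Lemma tcoef_tensor_mx t A v :
  tcoef (t *m tensor_mx n A) v = \sum_(w : word n m) tcoef t w * \prod_i A (w i) (v i).
Proof.
rewrite /tcoef mxE [RHS](reindex_onto enum_val enum_rank) /=; last first.
  by move=> w _; rewrite enum_rankK.
apply: eq_big => [a | a _]; first by rewrite enum_valK eqxx.
by rewrite mxE enum_valK; congr (_ * _); apply: eq_bigr => i _; rewrite enum_rankK.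
Qed.

End TensorPower.

Section Invariants.
Variables (n g : nat).
Implicit Types s t : tensor n (g + g).

Lemma sp_invariant0 : sp_invariant (0 : tensor n (g + g)).
Proof. by move=> A _; rewrite mul0mx. Qed.

Lemma sp_invariantD s t : sp_invariant s -> sp_invariant t -> sp_invariant (s + t).
Proof. by move=> hs ht A SpA; rewrite mulmxDl hs ?ht. Qed.

Lemma sp_invariantZ a t : sp_invariant t -> sp_invariant (a *: t).
Proof. by move=> ht A SpA; rewrite -scalemxAl ht. Qed.

Lemma sp_invariant_sum (I : Type) (r : seq I) (P : pred I) (F : I -> tensor n (g + g)) :
  (forall i, P i -> sp_invariant (F i)) -> sp_invariant (\sum_(i <- r | P i) F i).
Proof.
move=> hF; apply: (big_ind (@sp_invariant n g)) hF.
  exact: sp_invariant0.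
exact: sp_invariantD.
Qed.

Lemma sp_invariant_place t x :
  sp_invariant t -> sp_invariant (t *m place_repr n (g + g) x).
Proof. by move=> ht A SpA; rewrite -mulmxA -tensor_mx_place mulmxA ht. Qed.

Lemma sp_invariant_col_op t l :
  sp_invariant t -> sp_invariant (t *m col_op (place_repr n (g + g)) l).
Proof.
move=> ht; rewrite /col_op mulmx_sumr; apply: sp_invariant_sum => q _.
by rewrite -scalemxAr; apply/sp_invariantZ/sp_invariant_place.
Qed.

Lemma sp_invariant_row_op t l :
  sp_invariant t -> sp_invariant (t *m row_op (place_repr n (g + g)) l).
Proof.
move=> ht; rewrite /row_op mulmx_sumr; apply: sp_invariant_sum => q _.
exact/sp_invariant_place.
Qed.

Lemma sp_invariant_young_op t l :
  sp_invariant t -> sp_invariant (t *m young_op (place_repr n (g + g)) l).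
Proof. by move=> ht; rewrite mulmxA; apply/sp_invariant_row_op/sp_invariant_col_op. Qed.

(* The symplectic form is itself a symplectic transformation. *)
Lemma mu_tensor_invariant s t : sp_invariant s -> mu_tensor s t = (s *m t^T) 0 0.
Proof. by rewrite /mu_tensor => ->; last exact: in_Sp_symp. Qed.

End Invariants.

(** * Symplectic Gram-Schmidt *)

Section Rank.
Variable g : nat.

(* Orders the symplectic basis as e_1, f_1, e_2, f_2, ... *)
Definition sp_rank (p : 'I_(g + g)) : nat :=
  match split p with inl a => a.*2 | inr a => a.*2.+1 end.

Lemma sp_rankl (a : 'I_g) : sp_rank (lshift g a) = a.*2.
Proof. by rewrite /sp_rank (unsplitK (inl a)). Qed.

Lemma sp_rankr (a : 'I_g) : sp_rank (rshift g a) = a.*2.+1.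
Proof. by rewrite /sp_rank (unsplitK (inr a)). Qed.

Lemma sp_rank_inj : injective sp_rank.
Proof.
move=> p q; rewrite -(splitK p) -(splitK q).
case: (split p) => a; case: (split q) => b /=; rewrite ?sp_rankl ?sp_rankr.
- by move/double_inj/val_inj->.
- by move/(congr1 odd); rewrite /= !odd_double.
- by move/(congr1 odd); rewrite /= !odd_double.
- by case=> /double_inj/val_inj->.
Qed.

Lemma sp_rank_half (p : 'I_(g + g)) : ((sp_rank p)./2 < g)%N.
Proof.
rewrite -(splitK p); case: (split p) => a /=; rewrite ?sp_rankl ?sp_rankr.
  by rewrite doubleK.
by rewrite -[_./2]/(uphalf _) uphalf_double.
Qed.

Lemma sp_rank_exists r : (r < g + g)%N -> exists p, sp_rank p = r.
Proof.
move=> lt_r; have lt_h : (r./2 < g)%N by lia.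
have := odd_double_half r; case: (odd r) => eq_r.
  by exists (rshift g (Ordinal lt_h)); rewrite sp_rankr /= -[RHS]eq_r.
by exists (lshift g (Ordinal lt_h)); rewrite sp_rankl /= -[RHS]eq_r.
Qed.

(** The projection onto the span of the first a hyperbolic pairs. *)
Definition sp_trunc (a : nat) : 'M[rat]_(g + g) :=
  diag_mx (\row_q (sp_rank q < a.*2)%N%:R).

Lemma mul_sp_trunc m (A : 'M_(m, g + g)) a i q :
  (A *m sp_trunc a) i q = A i q * (sp_rank q < a.*2)%N%:R.
Proof. by rewrite mul_mx_diag !mxE. Qed.

Lemma sp_trunc_idem a : sp_trunc a *m sp_trunc a = sp_trunc a.
Proof.
apply/matrixP=> i q; rewrite mul_sp_trunc !mxE.
have [-> | _] := eqVneq i q; last by rewrite mulr0n mul0r.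
by case: (_ < _)%N; rewrite ?mulr1 ?mulr0.
Qed.

End Rank.

Section GramSchmidt.
Variables (g : nat) (S : 'M[rat]_(g + g)).
Local Notation J := (symp_mx g).
Local Notation P := (@sp_trunc g).
(** The leading block of order 2a of [S], completed by the identity; it is invertible when the
    leading minor is nonzero. *)
Let S' a := P a *m S *m P a + (1%:M - P a).
Hypothesis S_skew : S^T = - S.
Hypothesis S_minors : forall a, (a <= g)%N -> S' a \in unitmx.

Let blk (i : 'I_(g + g)) := (sp_rank i)./2.
(** The combination of the earlier pairs that makes row i of [c] orthogonal to them for [S]. *)
Let alpha (i : 'I_(g + g)) : 'rV[rat]_(g + g) :=
  - (row i S *m P (blk i) *m invmx (S' (blk i))).
Let c : 'M[rat]_(g + g) := \matrix_i (row i 1%:M + alpha i).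

Let blk_le i : (blk i <= g)%N. Proof. exact: ltnW (sp_rank_half i). Qed.

Let truncS a : S' a *m P a = P a *m S *m P a.
Proof.
by rewrite mulmxDl -mulmxA sp_trunc_idem mulmxBl mul1mx sp_trunc_idem subrr addr0.
Qed.

Let truncSC a : P a *m S' a = S' a *m P a.
Proof.
by rewrite truncS mulmxDr !mulmxA sp_trunc_idem mulmxBr mulmx1 sp_trunc_idem subrr addr0.
Qed.

Let alphaP i : alpha i *m P (blk i) = alpha i.
Proof.
have U := S_minors (blk_le i).
have comm : invmx (S' (blk i)) *m P (blk i) = P (blk i) *m invmx (S' (blk i)).
  by rewrite -[LHS](mulmxK U) -(mulmxA _ (P _)) truncSC !mulmxA mulVmx // mul1mx.
rewrite /alpha mulNmx -(mulmxA _ (invmx _)) comm mulmxA; congr (- (_ *m _)).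
by rewrite -mulmxA sp_trunc_idem.
Qed.

Let alpha0 i q : ((blk i).*2 <= sp_rank q)%N -> alpha i 0 q = 0.
Proof. by rewrite leqNgt => /negPf lt_q; rewrite -alphaP mul_sp_trunc lt_q mulr0. Qed.

Let cE i q : c i q = (i == q)%:R + alpha i 0 q.
Proof. by rewrite !mxE. Qed.

Let row_c i : row i c = delta_mx 0 i + alpha i.
Proof. by rewrite rowK row1. Qed.

Let blk_rank i : ((blk i).*2 <= sp_rank i)%N.
Proof. by rewrite /blk; lia. Qed.

Let cSP i : row i c *m S *m P (blk i) = 0.
Proof.
have U := S_minors (blk_le i).
have aS : alpha i *m S *m P (blk i) = - (row i S *m P (blk i)).
  rewrite -{1}alphaP -!(mulmxA (alpha i)) -truncS mulmxA /alpha !mulNmx.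
  by rewrite mulmxKV // -mulmxA sp_trunc_idem.
by rewrite row_c !mulmxDl -rowE aS subrr.
Qed.

Let D := c *m S *m c^T.

Let D_skew i j : D j i = - D i j.
Proof.
have DT : D^T = - D by rewrite /D !trmx_mul trmxK S_skew mulNmx mulmxN mulmxA.
by have /matrixP/(_ i j) := DT; rewrite !mxE.
Qed.

Let DE i j : D i j = (row i c *m S) 0 j + (row i c *m S *m (alpha j)^T) 0 0.
Proof.
have -> : D i j = (row i c *m S *m (row j c)^T) 0 0.
  by rewrite -row_mul mxE [RHS]mxE; apply: eq_bigr => k _; rewrite !mxE.
rewrite (row_c j) linearD mulmxDr mxE /=; congr (_ + _).
by rewrite trmx_delta -colE mxE.
Qed.

Let D_le i j : (blk j <= blk i)%N -> D i j = (row i c *m S) 0 j.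
Proof.
move=> le_ji; rewrite DE [X in _ + X]mxE big1 ?addr0 // => q _; rewrite [_^T _ _]mxE.
case: (ltnP (sp_rank q) (blk j).*2) => lt_q; last by rewrite alpha0 ?mulr0.
have := cSP i => /rowP/(_ q); rewrite mul_sp_trunc [RHS]mxE.
rewrite (leq_trans lt_q) ?leq_double // mulr1 => ->; exact: mul0r.
Qed.

Let D_lt i j : (blk j < blk i)%N -> D i j = 0.
Proof.
move=> lt_ji; rewrite D_le; last exact: ltnW.
have := cSP i => /rowP/(_ j); rewrite mul_sp_trunc [RHS]mxE.
have -> : (sp_rank j < (blk i).*2)%N by move: lt_ji; rewrite /blk; lia.
by rewrite mulr1.
Qed.

Let D_ne i j : blk i != blk j -> D i j = 0.
Proof.
by rewrite neq_ltn => /orP[lt_ij | /D_lt//]; rewrite D_skew D_lt // oppr0.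
Qed.

Let D_diag i : D i i = 0.
Proof. by have := D_skew i i; lra. Qed.

Let blkl a : blk (lshift g a) = a. Proof. by rewrite /blk sp_rankl doubleK. Qed.
Let blkr a : blk (rshift g a) = a.
Proof. by rewrite /blk sp_rankr -[_./2]/(uphalf _) uphalf_double. Qed.

(** Otherwise row i of [c] would be a nonzero vector in the span of the first a+1 pairs and
    orthogonal to that span, against the invertibility of [S' a.+1]. *)
Let D_neq0 (a : 'I_g) : D (lshift g a) (rshift g a) != 0.
Proof.
set i := lshift g a; set j := rshift g a; apply: contraTneq isT => Dij0.
have cP : row i c *m P a.+1 = row i c.
  apply/rowP=> q; rewrite mul_sp_trunc; case: ltnP => lt_q; first by rewrite mulr1.
  rewrite mulr0 mxE cE alpha0 ?addr0; last by apply: leq_trans lt_q; rewrite blkl leq_double.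
  case: eqP lt_q => // <-; by rewrite sp_rankl leq_double ltnn.
have cS0 : row i c *m S *m P a.+1 = 0.
  apply/rowP=> q; rewrite mul_sp_trunc [RHS]mxE.
  case: ltnP => lt_q; last by rewrite mulr0.
  rewrite mulr1 -D_le ?blkl; last by rewrite /blk; lia.
  have [lt_qa | le_aq] := ltnP (sp_rank q) a.*2.
    by rewrite D_lt // blkl /blk; lia.
  have [-> | ne_qi] := eqVneq q i; first exact: D_diag.
  suff -> : q = j by [].
  apply: sp_rank_inj; rewrite sp_rankr; move: ne_qi.
  by rewrite -(inj_eq (@sp_rank_inj g)) sp_rankl; lia.
have /S_minors U : (a.+1 <= g)%N by [].
have : row i c *m S' a.+1 = 0.
  by rewrite mulmxDr mulmxBr mulmx1 !mulmxA cP cS0 subrr addr0.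
move/(congr1 (mulmx^~ (invmx (S' a.+1)))); rewrite /= mulmxK // mul0mx => /rowP/(_ i).
rewrite mxE cE eqxx alpha0 ?mxE ?addr0 => [|/=]; last by rewrite blkl sp_rankl.
by move/eqP; rewrite oner_eq0.
Qed.

Lemma symplectic_gram_schmidt : exists b : 'M[rat]_(g + g),
  [/\ forall p q, (sp_rank p < sp_rank q)%N -> b p q = 0,
      forall p, b p p != 0
    & b *m S *m b^T = J].
Proof.
(* [D] has only 2 x 2 blocks, one per pair; dividing the second row of each pair by the pairing
   turns [D] into [J]. *)
pose w (i : 'I_(g + g)) :=
  if split i is inr a then (D (lshift g a) (rshift g a))^-1 else 1.
have wl a : w (lshift g a) = 1 by rewrite /w (unsplitK (inl a)).
have wr a : w (rshift g a) = (D (lshift g a) (rshift g a))^-1.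
  by rewrite /w (unsplitK (inr a)).
have w0 i : w i != 0.
  by rewrite /w; case: (split i) => a; rewrite ?oner_eq0 // invr_eq0 D_neq0.
exists (diag_mx (\row_i w i) *m c); split=> [p q lt_pq | p | ].
- rewrite mul_diag_mx mxE [X in X * _]mxE cE alpha0 ?addr0; last by rewrite /blk; lia.
  by case: eqP lt_pq => [->|_ _]; rewrite ?ltnn ?mulr0.
- by rewrite mul_diag_mx mxE [X in X * _]mxE cE eqxx alpha0 ?addr0 // mulr1.
rewrite trmx_mul tr_diag_mx !mulmxA -2!(mulmxA (diag_mx _)) -/D.
apply/matrixP=> i j.
have -> : (diag_mx (\row_i w i) *m D *m diag_mx (\row_i w i)) i j
          = w i * D i j * w j.
  rewrite mul_mx_diag mxE [X in _ * X]mxE mul_diag_mx mxE; congr (_ * _ * _).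
  exact: mxE.
rewrite -(splitK i) -(splitK j); case: (split i) => a; case: (split j) => b /=.
- rewrite symp_mxll; have [<- | ne_ab] := eqVneq a b.
    by rewrite D_diag mulr0 mul0r.
  by rewrite D_ne ?mulr0 ?mul0r // !blkl.
- rewrite symp_mxlr wl wr mul1r; have [<- | ne_ab] := eqVneq a b.
    by rewrite divff ?D_neq0 ?eqxx.
  have Dab : D (lshift g a) (rshift g b) = 0 by apply: D_ne; rewrite blkl blkr.
  by rewrite Dab mul0r.
- rewrite symp_mxrl wl wr mulr1; have [<- | ne_ab] := eqVneq a b.
    by rewrite (D_skew (lshift g a)) mulrN mulVf ?D_neq0 ?eqxx.
  have Dab : D (rshift g a) (lshift g b) = 0 by apply: D_ne; rewrite blkl blkr.
  by rewrite Dab mulr0 oppr0.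
rewrite symp_mxrr; have [<- | ne_ab] := eqVneq a b.
  by rewrite D_diag mulr0 mul0r.
by rewrite D_ne ?mulr0 ?mul0r // !blkr.
Qed.

End GramSchmidt.

Lemma poly_horner_eq0 (R : numDomainType) (p : {poly R}) : (forall z, p.[z] = 0) -> p = 0.
Proof.
move=> p0; apply: (@roots_geq_poly_eq0 _ p [seq i%:R | i <- iota 0 (size p)]).
- by apply/allP=> z _; rewrite /root p0.
- by rewrite map_inj_uniq ?iota_uniq // => i j /eqP; rewrite eqr_nat => /eqP.
by rewrite size_map size_iota.
Qed.

(** * The highest weight coefficient *)

Section ColumnAntisymmetry.
Variables (n m : nat) (l : young n).
Implicit Types (t : tensor n m) (v : word n m).

Lemma tcoef_col_op_perm t v q : q \in col_stab n l ->
  tcoef (t *m col_op (place_repr n m) l) (word_perm v q) =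
    (-1) ^+ (odd_perm q) * tcoef (t *m col_op (place_repr n m) l) v.
Proof.
by move=> Cq; rewrite -tcoef_place -mulmxA mul_col_op_repr // -scalemxAr tcoefZ.
Qed.

Lemma tcoef_col_op_eq0 t v i j : i != j -> box_col l i = box_col l j -> v i = v j ->
  tcoef (t *m col_op (place_repr n m) l) v = 0.
Proof.
move=> ne_ij c_ij v_ij; have := tcoef_col_op_perm t v (col_stab_tperm c_ij).
rewrite odd_tperm ne_ij expr1 (_ : word_perm v _ = v); first by lra.
by apply/ffunP=> h; rewrite ffunE; case: tpermP => // ->.
Qed.

(** Two boxes of the first column carry the same letter, by the pigeonhole principle. *)
Lemma col_op_size_eq0 t : (m < size l)%N -> t *m col_op (place_repr n m) l = 0.
Proof.
move=> lt_m; apply: tcoefP => v; rewrite tcoef0.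
have first_col (r : 'I_(size l)) : exists i : 'I_n, box_row l i = r /\ box_col l i = 0%N.
  by apply: box_exists; rewrite young_nth_gt0.
have /fin_all_exists[f fP] := first_col.
have [/injectiveP inj | ] := boolP (injectiveb (fun r => v (f r))).
  by have := leq_card _ inj; rewrite !card_ord leqNgt lt_m.
case/injectivePn=> r [r' ne_r eq_v]; apply: (tcoef_col_op_eq0 _ _ _ eq_v).
  by apply: contraNneq ne_r => eq_f; apply/eqP/val_inj; rewrite /= -(fP r).1 -(fP r').1 eq_f.
by rewrite (fP r).2 (fP r').2.
Qed.

End ColumnAntisymmetry.

Lemma sp_trunc_symp g a : sp_trunc g a *m symp_mx g = symp_mx g *m sp_trunc g a.
Proof.
have lt_lr (b : 'I_g) : (sp_rank (rshift g b) < a.*2)%N = (sp_rank (lshift g b) < a.*2)%N.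
  by rewrite sp_rankl sp_rankr; lia.
apply/matrixP=> i j; rewrite mul_sp_trunc mul_diag_mx mxE [X in X * _]mxE.
rewrite -(splitK i) -(splitK j); case: (split i) => b; case: (split j) => c /=.
- by rewrite symp_mxll mulr0 mul0r.
- rewrite symp_mxlr; have [->|] := eqVneq b c; last by rewrite mul0r mulr0.
  by rewrite lt_lr mulrC.
- rewrite symp_mxrl; have [->|] := eqVneq b c; last by rewrite oppr0 mul0r mulr0.
  by rewrite lt_lr mulrC.
by rewrite symp_mxrr mulr0 mul0r.
Qed.

Section Spherical.
Variables (n g : nat) (l : young n) (w0 : word n (g + g)).
Hypothesis w0P : forall i, sp_rank (w0 i) = box_row l i.
Local Notation rG := (place_repr n (g + g)).
Local Notation J := (symp_mx g).
Implicit Types (t : tensor n (g + g)) (v : word n (g + g)) (A b : 'M[rat]_(g + g)).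

Lemma tensor_mx_row_op A : tensor_mx n A *m row_op rG l = row_op rG l *m tensor_mx n A.
Proof.
rewrite /row_op mulmx_sumr mulmx_suml; apply: eq_bigr => q _.
exact: tensor_mx_place.
Qed.

(* Of all words that are injective on columns, w0 has the least ranks. *)
Lemma tcoef_triangular t b :
    (forall p q, (sp_rank p < sp_rank q)%N -> b p q = 0) ->
  tcoef (t *m col_op rG l *m tensor_mx n b^T) w0 =
    (\prod_i b (w0 i) (w0 i)) * tcoef (t *m col_op rG l) w0.
Proof.
move=> b_tri; rewrite tcoef_tensor_mx (bigD1 w0) //= [X in _ + X]big1 => [|v ne_v].
  by rewrite addr0 mulrC; congr (_ * _); apply: eq_bigr => i _; rewrite mxE.
apply/eqP/negPn/negP; rewrite mulf_eq0 negb_or => /andP[nz_t /prodf_neq0 nz_b].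
have le_row i : (sp_rank (v i) <= box_row l i)%N.
  rewrite leqNgt; apply: contra (nz_b i isT) => lt_v.
  by rewrite mxE b_tri ?w0P.
(* If the rank of [v i] were less than the row of i, the box above i in the row of that index would
   carry the same letter by induction, against antisymmetry. *)
have eq_row i : sp_rank (v i) = box_row l i.
  have [N] := ubnP (box_row l i); elim: N i => // N IHN i lt_N.
  apply/eqP; rewrite eqn_leq le_row leqNgt; apply/negP=> lt_v.
  have [j [rj cj]] := box_up (ltnW lt_v).
  have rvj : sp_rank (v j) = sp_rank (v i).
    by rewrite IHN ?rj //; apply: leq_trans lt_v _.
  have ne_ji : j != i by apply: contraTneq lt_v => <-; rewrite rj -{1}rvj ltnn.
  by rewrite (tcoef_col_op_eq0 _ ne_ji cj (sp_rank_inj rvj)) eqxx in nz_t.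
by case/eqP: ne_v; apply/ffunP=> i; apply: sp_rank_inj; rewrite eq_row w0P.
Qed.

Section Vanishing.
Variable t : tensor n (g + g).
Hypothesis t_inv : sp_invariant t.
Local Notation F := (t *m col_op rG l).
Hypothesis F0 : tcoef F w0 = 0.

(** Gram-Schmidt gives a triangular b with [b A] symplectic; as [F] is invariant, its coefficient 0
    is a nonzero multiple of the one sought. *)
Lemma tcoef_generic_eq0 A :
    (forall a, (a <= g)%N -> sp_trunc g a *m (A *m J *m A^T) *m sp_trunc g a
       + (1%:M - sp_trunc g a) \in unitmx) ->
  tcoef (F *m tensor_mx n A^T) w0 = 0.
Proof.
move=> minors; have [|b [b_tri b_diag bJ]] := symplectic_gram_schmidt _ minors.
  by rewrite !trmx_mul trmxK symp_mx_tr mulNmx mulmxN mulmxA.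
have Sp_bA : in_Sp (b *m A) by apply/in_SpP; rewrite trmx_mul !mulmxA in bJ *.
have FbA : F *m tensor_mx n A^T *m tensor_mx n b^T = F.
  rewrite -mulmxA -tensor_mxM -trmx_mul.
  by apply: sp_invariant_col_op => //; apply: in_Sp_tr.
have := F0; rewrite -{1}FbA -(mulmxA t) -tensor_mx_col_op mulmxA tcoef_triangular //.
move/eqP; rewrite mulf_eq0 => /orP[ | /eqP->//].
by apply: contraTeq => _; apply/prodf_neq0 => i _; apply: b_diag.
Qed.

(** On the line from [A] at z = 0 to the identity at z = 1, the coefficient is a polynomial p and
    the product of the leading minors a polynomial q. The generic case gives p q = 0, while q(1) is
    not 0. *)
Lemma tcoef_eq0_dense A : tcoef (F *m tensor_mx n A^T) w0 = 0.
Proof.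
pose C (M : 'M[rat]_(g + g)) : 'M[{poly rat}]_(g + g) := map_mx polyC M.
pose Ap := C A + 'X *: C (1%:M - A).
pose Az z := A + z *: (1%:M - A).
have evC z M : map_mx (horner_eval z) (C M) = M.
  by apply/matrixP=> i j; rewrite !mxE /horner_eval hornerC.
have evA z : map_mx (horner_eval z) Ap = Az z.
  by apply/matrixP=> i j; rewrite !mxE /horner_eval !(hornerE, hornerC).
pose p := \sum_v (tcoef F v)%:P * \prod_i Ap (w0 i) (v i).
have pE z : p.[z] = tcoef (F *m tensor_mx n (Az z)^T) w0.
  rewrite tcoef_tensor_mx horner_sum; apply: eq_bigr => v _.
  rewrite hornerM hornerC horner_prod; congr (_ * _); apply: eq_bigr => i _.
  by rewrite -evA [in RHS]mxE [in RHS]mxE.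
pose Mp a := C (sp_trunc g a) *m (Ap *m C J *m Ap^T) *m C (sp_trunc g a)
  + (C 1%:M - C (sp_trunc g a)).
pose Mz a z := sp_trunc g a *m (Az z *m J *m (Az z)^T) *m sp_trunc g a
  + (1%:M - sp_trunc g a).
pose q := \prod_(a < g.+1) \det (Mp a).
have qE z : q.[z] = \prod_(a < g.+1) \det (Mz a z).
  rewrite horner_prod; apply: eq_bigr => a _.
  have -> : (\det (Mp a)).[z] = horner_eval z (\det (Mp a)) by [].
  rewrite -det_map_mx /Mp map_mxD map_mxB !map_mxM -map_trmx /= !evA !evC.
  by [].
have pq0 : p * q = 0.
  apply: poly_horner_eq0 => z; rewrite hornerM.
  have [q0 | nz_q] := eqVneq q.[z] 0; first by rewrite q0 mulr0.
  rewrite pE tcoef_generic_eq0 ?mul0r // => a le_ag.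
  rewrite unitmxE unitfE; move: nz_q; rewrite qE => /prodf_neq0.
  by move/(_ (Ordinal (le_ag : (a < g.+1)%N)) isT).
have nz_q : q != 0.
  apply/eqP=> q0; have := qE 1; rewrite q0 horner0 => /esym/eqP.
  apply/negP/prodf_neq0 => a _; rewrite -unitfE -unitmxE.
  have -> : Mz a 1 = sp_trunc g a *m J *m sp_trunc g a + (1%:M - sp_trunc g a).
    have A1 : Az 1 = 1%:M by rewrite /Az scale1r addrC subrK.
    by rewrite /Mz A1 trmx1 mul1mx mulmx1.
  set P := sp_trunc g a; have PP : P *m P = P by apply: sp_trunc_idem.
  have PJ : P *m J = J *m P by apply: sp_trunc_symp.
  have PJP : P *m J *m P = J *m P by rewrite PJ -mulmxA PP.
  have QJP : (1%:M - P) *m (J *m P) = 0 by rewrite mulmxBl mul1mx mulmxA PJP subrr.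
  have JPQ : J *m P *m (1%:M - P) = 0 by rewrite mulmxBr mulmx1 -mulmxA PP subrr.
  have QQ : (1%:M - P) *m (1%:M - P) = 1%:M - P.
    by rewrite mulmxBl mul1mx mulmxBr mulmx1 PP subrr subr0.
  have JPJP : J *m P *m (J *m P) = - P.
    by rewrite -mulmxA (mulmxA P) PJP mulmxA symp_mx_sqr mulNmx mul1mx.
  have PQ1 : P + (1%:M - P) = 1%:M by rewrite addrC subrK.
  rewrite PJP; move: (1%:M - P) QJP JPQ QQ PQ1 => Q QJP JPQ QQ PQ1.
  have /mulmx1_unit[] // : (J *m P + Q) *m (- (J *m P) + Q) = 1%:M.
  by rewrite mulmxDl !mulmxDr !mulmxN JPQ QJP QQ JPJP opprK oppr0 add0r addr0.
have p0 : p = 0 by apply/eqP; move/eqP: pq0; rewrite mulf_eq0 (negPf nz_q) orbF.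
by have := pE 0; rewrite p0 horner0 /Az scale0r addr0 => <-.
Qed.

Let s := F *m row_op rG l.
(** The exponent of the entry of [A] at x in the monomial attached to v. *)
Let count v x := #|[pred i | (w0 i, v i) == x]|.

Lemma tcoef_row_op_dense A : \sum_v tcoef s v * \prod_i A (w0 i) (v i) = 0.
Proof.
have := tcoef_tensor_mx s A^T w0.
rewrite /s -mulmxA -tensor_mx_row_op mulmxA tcoef_row_op big1 => [|p /row_stabP Rp].
  move=> E; rewrite [RHS]E; apply: eq_bigr => v _; congr (_ * _).
  by apply: eq_bigr => i _; rewrite mxE.
rewrite (_ : word_perm w0 p = w0) ?tcoef_eq0_dense //.
by apply/ffunP=> i; rewrite ffunE; apply: sp_rank_inj; rewrite !w0P Rp.
Qed.

(* Scaling one matrix entry by z and extracting a coefficient in z isolates the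
   words in which that entry is used a given number of times. *)
Lemma tcoef_isolate (L : seq ('I_(g + g) * 'I_(g + g))) v A :
  \sum_(u | all (fun x => count u x == count v x) L)
    tcoef s u * \prod_i A (w0 i) (u i) = 0.
Proof.
elim: L A => [|x L IHL] A; first exact: tcoef_row_op_dense.
pose Az z := \matrix_(p, q) ((if (p, q) == x then z else 1) * A p q).
pose P u := all (fun y => count u y == count v y) L.
pose f : {poly rat} :=
  \sum_(u | P u) (tcoef s u * \prod_i A (w0 i) (u i)) *: 'X^(count u x).
have f0 : f = 0.
  apply: poly_horner_eq0 => z; rewrite -[RHS](IHL (Az z)) horner_sum.
  apply: eq_bigr => u _; rewrite hornerZ hornerXn -mulrA; congr (_ * _).
  under [RHS]eq_bigr do rewrite mxE.
  by rewrite big_split /= -big_mkcond /= prodr_const mulrC.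
have := congr1 (fun h : {poly rat} => h`_(count v x)) f0.
rewrite coef0 coef_sum => E; rewrite -[RHS]E [LHS]big_mkcondl /=.
apply: eq_bigr => u _; rewrite coefZ coefXn eq_sym.
by case: (_ == _); rewrite ?mulr1 ?mulr0.
Qed.

(** Words with the same monomial differ by a row permutation, which preserves the coefficients of
    [s]. So the isolated sum, at the all-ones matrix, is a positive multiple of the coefficient at
    v. *)
Lemma spherical_eq0 : t *m young_op rG l = 0.
Proof.
rewrite mulmxA -/s; apply: tcoefP => v; rewrite tcoef0.
pose L := enum {: 'I_(g + g) * 'I_(g + g)}.
have same u : all (fun x => count u x == count v x) L -> tcoef s u = tcoef s v.
  move/allP=> eq_uv.
  pose tup (u : word n (g + g)) := [tuple (w0 i, u i) | i < n].
  have countE u' x : seq.count_mem x (tup u') = count u' x.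
    rewrite -sum1_count /count -sum1_card big_map big_enum_cond /=.
    by apply: eq_bigl => i; rewrite inE.
  have /tuple_permP[p def_u] : perm_eq (tup u) (tup v).
    by apply/allP=> x _; rewrite /= !countE eq_uv ?mem_enum.
  have up i : (w0 i, u i) = (w0 (p i), v (p i)).
    have := congr1 (fun w => nth (w0 i, u i) w i) def_u.
    by rewrite -!tnth_nth !tnth_mktuple.
  have Rp : p \in row_stab n l.
    by apply/row_stabP=> i; rewrite -!w0P; case: (up i) => ->.
  have -> : u = word_perm v p by apply/ffunP=> i; rewrite ffunE; case: (up i).
  by rewrite -tcoef_place -mulmxA mul_row_op_repr.
have := tcoef_isolate L v (const_mx 1).
rewrite (eq_bigr (fun=> tcoef s v)) => [|u /same ->]; last first.
  by rewrite big1 ?mulr1 // => i _; rewrite mxE.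
rewrite sumr_const => /eqP; rewrite mulrn_eq0 => /orP[/eqP/card0_eq/(_ v) | /eqP//].
by rewrite unfold_in => /negP[]; apply/allP.
Qed.

End Vanishing.

(* A diagonal symplectic matrix scales the highest weight coefficient by
   2 ^ (l_(2a) - l_(2a+1)). *)
Lemma spherical_weight t (a : 'I_g) : sp_invariant t ->
    tcoef (t *m col_op rG l) w0 != 0 ->
  nth 0%N l a.*2 = nth 0%N l a.*2.+1.
Proof.
move=> t_inv nz_t; pose el := lshift g a; pose er := rshift g a.
pose z i : rat := (if i == el then 2%:R else 1) * (if i == er then 2%:R^-1 else 1).
pose s : 'M[rat]_(g + g) := diag_mx (\row_i z i).
have Sp_s : in_Sp s.
  apply/in_SpP; rewrite tr_diag_mx; apply/matrixP=> i j.
  rewrite mul_mx_diag mxE [X in _ * X]mxE mul_diag_mx mxE [X in X * _ * _]mxE.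
  rewrite -(splitK i) -(splitK j); case: (split i) => b; case: (split j) => c /=.
  - by rewrite symp_mxll mulr0 mul0r.
  - rewrite symp_mxlr; have [<-|] := eqVneq b c; last by rewrite mulr0 mul0r.
    rewrite /z /el /er eq_lrshift eq_rlshift eq_lshift eq_rshift.
    by case: (b == a); rewrite ?mulr1 ?mul1r ?divff ?pnatr_eq0.
  - rewrite symp_mxrl; have [<-|] := eqVneq b c; last by rewrite oppr0 mulr0 mul0r.
    rewrite /z /el /er eq_lrshift eq_rlshift eq_lshift eq_rshift.
    by case: (b == a); rewrite ?mulr1 ?mul1r // mulrN1 mulNr mulVf ?pnatr_eq0.
  by rewrite symp_mxrr mulr0 mul0r.
have s_tri p q : (sp_rank p < sp_rank q)%N -> s p q = 0.
  by rewrite /s !mxE; case: eqP => [->|]; rewrite ?ltnn // mulr0n.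
have := tcoef_triangular t s_tri.
rewrite (sp_invariant_col_op l t_inv (in_Sp_tr Sp_s)).
rewrite -[LHS]mul1r => /(mulIf nz_t); under eq_bigr do rewrite !mxE eqxx mulr1n.
have cardP (e : 'I_(g + g)) : #|[pred i | w0 i == e]| = nth 0%N l (sp_rank e).
  rewrite -card_box_row; apply: eq_card => i; rewrite !inE -w0P.
  by rewrite (inj_eq (@sp_rank_inj g)).
rewrite big_split /= -!big_mkcond /= !prodr_const !cardP sp_rankl sp_rankr.
rewrite exprVn => /esym/divr1_eq; by apply: ieexprIn; rewrite ?ltr0n ?pnatr_eq1.
Qed.

End Spherical.

(** * Shapes occurring in the invariants, and uniqueness *)

Lemma row_word_exists n g (l : young n) : (size l <= g + g)%N ->
  exists w : word n (g + g), forall i, sp_rank (w i) = box_row l i.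
Proof.
move=> le_l; have rank_ex (i : 'I_n) : exists p : 'I_(g + g), sp_rank p = box_row l i.
  by apply: sp_rank_exists; apply: leq_trans (box_row_lt l i) le_l.
have /fin_all_exists[w wP] := rank_ex.
by exists [ffun i => w i] => i; rewrite ffunE.
Qed.

Lemma nth_delta_rows s r : nth 0%N (delta_rows s) r = nth 0%N s r./2.
Proof.
by elim: s r => [|a s IHs] [|[|r]] //=; rewrite ?nth_nil.
Qed.

Lemma young_delta_exists k g (l : young k.*2) : (size l <= g + g)%N ->
    (forall a, (a < g)%N -> nth 0%N l a.*2 = nth 0%N l a.*2.+1) ->
  exists la : young k, l = young_delta la /\ (height la <= g)%N.
Proof.
(* Every other row of [l], starting with the first. *)
move=> le_l pairs; pose s := mkseq (fun a => nth 0%N l a.*2) (uphalf (size l)).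
have s_nth a : nth 0%N s a = nth 0%N l a.*2.
  have [lt_a | le_a] := ltnP a (uphalf (size l)); first by rewrite nth_mkseq.
  by rewrite !nth_default ?size_mkseq //; lia.
have size_s : (size s <= g)%N by rewrite size_mkseq; lia.
have delta_s r : nth 0%N (delta_rows s) r = nth 0%N l r.
  rewrite nth_delta_rows s_nth -[in RHS](odd_double_half r).
  case: (odd r) => //=; have [lt_r | le_r] := ltnP r./2 g; first by rewrite pairs.
  by rewrite !nth_default //; lia.
have s_gt0 a : (a < size s)%N -> (0 < nth 0%N s a)%N.
  by rewrite s_nth young_nth_gt0 size_mkseq; lia.
have sorted_s : sorted geq s.
  apply/(sortedP 0%N) => a _; rewrite !s_nth /=; apply: young_nth_leq; lia.
have s0 : 0%N \notin s by apply/(nthP 0%N) => -[a /s_gt0]; rewrite lt0n => /eqP.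
have sP m : sumn s = m -> is_young m s.
  by move=> sum_s; apply/and3P; split=> //; apply/eqP.
have /and3P[_ ds0 /eqP sum_ds] := delta_rowsP (Young (sP _ erefl)).
have eq_l : delta_rows s = l.
  by apply: eq_nth_notin0 => //; have /and3P[] := youngP l.
have sum_s : sumn s = k.
  by apply: double_inj; rewrite -sum_ds /= eq_l young_sumn.
by exists (Young (sP _ sum_s)); split=> //; apply: val_inj.
Qed.

Section SphericalShape.
Variables (g k : nat).
Local Notation rG := (place_repr k.*2 (g + g)).
Implicit Types (t : tensor k.*2 (g + g)) (l : young k.*2).

Lemma sp_young_op_shape t l : sp_invariant t -> t *m young_op rG l != 0 ->
  exists la : young k, l = young_delta la /\ (height la <= g)%N.
Proof.
move=> t_inv nz_t; have le_l : (size l <= g + g)%N.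
  rewrite leqNgt; apply: contra nz_t => lt_l.
  by rewrite mulmxA col_op_size_eq0 ?mul0mx.
have [w wP] := row_word_exists le_l.
have nz_w : tcoef (t *m col_op rG l) w != 0.
  by apply: contraNneq nz_t => t0; rewrite (spherical_eq0 wP).
apply: young_delta_exists le_l _ => a lt_a.
exact: (@spherical_weight _ _ _ _ wP t (Ordinal lt_a) t_inv).
Qed.

(** A combination of [s] and [t] whose highest weight coefficient vanishes is killed by the Young
    symmetrizer. *)
Lemma sp_young_op_unique s t l : sp_invariant s -> sp_invariant t ->
    t *m young_op rG l != 0 ->
  exists a, s *m young_op rG l = a *: (t *m young_op rG l).
Proof.
move=> s_inv t_inv nz_t; have [la [def_l le_la]] := sp_young_op_shape t_inv nz_t.
have le_l : (size l <= g + g)%N.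
  by rewrite leqNgt; apply: contra nz_t => lt_l; rewrite mulmxA col_op_size_eq0 ?mul0mx.
have [w wP] := row_word_exists le_l.
pose c t' := tcoef (t' *m col_op rG l) w.
have nz_w : c t != 0 by apply: contraNneq nz_t => t0; rewrite (spherical_eq0 wP).
pose u := s + (- (c s / c t)) *: t.
have u_inv : sp_invariant u by apply: sp_invariantD => //; apply: sp_invariantZ.
have u0 : c u = 0.
  by rewrite /c mulmxDl -scalemxAl tcoefD tcoefZ mulNr divfK ?subrr.
exists (c s / c t); apply/eqP; rewrite -subr_eq0 -scaleNr scalemxAl -mulmxDl.
by rewrite -/u (spherical_eq0 wP u_inv u0).
Qed.

End SphericalShape.

(** * Nonzero invariants *)

Section DominoSign.
Variables (I T : finType) (e : I * bool -> T) (f : T -> I * bool).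
Hypotheses (eK : cancel e f) (fK : cancel f e).

Let e_inj : injective e := can_inj eK.

(* A permutation of a set of pairs is even up to the pairs that it flips: its
   actions on the first and on the second elements are conjugate. *)
Lemma odd_perm_domino (q : {perm T}) (p : {perm I}) (c : I -> bool) :
    (forall D b, q (e (D, b)) = e (p D, b (+) c D)) ->
  odd_perm q = \big[addb/false]_D c D.
Proof.
move=> qE; pose flip D := if c D then tperm (e (D, false)) (e (D, true)) else 1%g.
have flipE D E b : flip D (e (E, b)) = e (E, b (+) (c D && (D == E))).
  rewrite /flip; case: (c D); last by rewrite perm1 addbF.
  have [-> | ne_DE] := eqVneq D E; last first.
    by rewrite addbF tpermD // (inj_eq e_inj) xpair_eqE negb_and ne_DE.
  by case: b; rewrite ?tpermL ?tpermR.
have prodE s E b : uniq s ->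
    (\prod_(D <- s) flip D)%g (e (E, b)) = e (E, b (+) (c E && (E \in s))).
  elim: s b => [|D s IHs] b; first by rewrite big_nil perm1 andbF addbF.
  case/andP=> s'D us; rewrite big_cons permM flipE IHs // inE -addbA; congr (e (_, _ (+) _)).
  have [<- | _] /= := eqVneq D E; last by rewrite andbF.
  by rewrite (negPf s'D) andbF addbF andbT.
pose half a := fun i : T => let: (D, b) := f i in e (if b == a then p D else D, b).
have half_inj a : injective (half a).
  move=> i j; rewrite -(fK i) -(fK j); case: (f i) => D b; case: (f j) => E b'.
  rewrite /half !eK => /e_inj[eq_p eq_b]; congr (e (_, _)) => //.
  by move: eq_p; rewrite eq_b; case: eqP => // _ /perm_inj.
pose swap := fun i : T => let: (D, b) := f i in e (D, ~~ b).
have swap_inj : injective swap.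
  move=> i j; rewrite -(fK i) -(fK j); case: (f i) => D b; case: (f j) => E b'.
  by rewrite /swap !eK => /e_inj[-> /negb_inj ->].
have halfE a D b : perm (half_inj a) (e (D, b)) = e (if b == a then p D else D, b).
  by rewrite permE /half eK.
have swapE D b : perm swap_inj (e (D, b)) = e (D, ~~ b) by rewrite permE /swap eK.
have half_conj : (perm (half_inj false) ^ perm swap_inj)%g = perm (half_inj true).
  apply/permP=> i; rewrite -(fK i); case: (f i) => D b.
  by rewrite -{1}[b]negbK -swapE permJ halfE swapE halfE; case: b.
have -> : q = ((\prod_(D <- index_enum I) flip D) * perm (half_inj false)
               * perm (half_inj true))%g.
  apply/permP=> i; rewrite -(fK i); case: (f i) => D b.
  rewrite qE !permM prodE ?index_enum_uniq // mem_index_enum andbT !halfE.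
  by case: (b (+) c D).
rewrite !odd_permM -half_conj odd_permJ -addbA addbb addbF.
rewrite (big_morph _ (@odd_permM T) (@odd_perm1 T)); apply: eq_bigr => D _.
rewrite /flip; case: (c D); last exact: odd_perm1.
by rewrite odd_tperm (inj_eq e_inj) xpair_eqE andbF.
Qed.

End DominoSign.

Section DominoTensor.
Variables (g k n : nat) (e : 'I_k * bool -> 'I_n) (f : 'I_n -> 'I_k * bool).
Hypotheses (eK : cancel e f) (fK : cancel f e).
Local Notation J := (symp_mx g).

(** The product of k copies of the invariant 2-tensor of the form, copy D occupying positions
    [e (D, false)] and [e (D, true)]. *)
Definition domino_tensor : tensor n (g + g) :=
  \row_a \prod_(D < k) J ((enum_val a : word n (g + g)) (e (D, false)))
                         ((enum_val a : word n (g + g)) (e (D, true))).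

Lemma tcoef_domino v :
  tcoef domino_tensor v = \prod_(D < k) J (v (e (D, false))) (v (e (D, true))).
Proof. by rewrite /tcoef mxE enum_rankK. Qed.

Lemma domino_tensor_invariant : sp_invariant domino_tensor.
Proof.
move=> A /in_Sp_tr/in_SpP; rewrite trmxK => AJ.
apply: tcoefP => u; rewrite tcoef_tensor_mx tcoef_domino -AJ.
pose G D (x : 'I_(g + g) * 'I_(g + g)) :=
  A x.1 (u (e (D, false))) * J x.1 x.2 * A x.2 (u (e (D, true))).
have -> : \prod_(D < k) (A^T *m J *m A) (u (e (D, false))) (u (e (D, true)))
        = \prod_(D < k) \sum_x G D x.
  apply: eq_bigr => D _; transitivity (\sum_x \sum_y G D (x, y)).
    rewrite mxE exchange_big /=.
    apply: eq_bigr => y _; rewrite mxE mulr_suml; apply: eq_bigr => x _.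
    by rewrite mxE.
  by rewrite pair_bigA; apply: eq_bigr => -[].
rewrite bigA_distr_bigA /=.
(* A word amounts to the choice of a pair of letters for each domino. *)
pose toh (v : word n (g + g)) := [ffun D => (v (e (D, false)), v (e (D, true)))].
pose ofh (h : {ffun 'I_k -> 'I_(g + g) * 'I_(g + g)}) : word n (g + g) :=
  [ffun i => let: (D, b) := f i in if b then (h D).2 else (h D).1].
rewrite (reindex toh) /=; last first.
  exists ofh => [v _ | h _]; apply/ffunP=> i; rewrite !ffunE.
    rewrite -{2}(fK i); case: (f i) => D [] /=; rewrite ffunE //.
  by rewrite !eK; case: (h i).
apply: eq_bigr => v _; rewrite tcoef_domino.
have -> : \prod_i A (v i) (u i) = \prod_D \prod_b A (v (e (D, b))) (u (e (D, b))).
  rewrite pair_big /= (reindex e); last by exists f.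
  by apply: eq_bigr => -[D b] _.
rewrite -big_split; apply: eq_bigr => D _; rewrite /G ffunE /= big_bool /=.
ring.
Qed.

End DominoTensor.

(** Each box of [la] becomes a vertical domino of the doubled diagram; counting makes this injection
    of boxes a bijection. *)
Lemma domino_boxes (k : nat) (la : young k) :
  exists (e : 'I_k * bool -> 'I_k.*2) (f : 'I_k.*2 -> 'I_k * bool),
    [/\ cancel e f, cancel f e,
        forall D b, box_row (young_delta la) (e (D, b)) = ((box_row la D).*2 + b)%N
      & forall D b, box_col (young_delta la) (e (D, b)) = box_col la D].
Proof.
have box_ex (x : 'I_k * bool) : exists i : 'I_k.*2,
    box_row (young_delta la) i = ((box_row la x.1).*2 + x.2)%N
    /\ box_col (young_delta la) i = box_col la x.1.
  apply: box_exists; rewrite nth_delta_rows addnC half_bit_double.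
  exact: box_col_lt.
have /fin_all_exists[e eP] := box_ex.
have e_inj : injective e.
  move=> [D b] [E c] eq_e; have [/= rD cD] := eP (D, b); have [/= rE cE] := eP (E, c).
  rewrite eq_e rE in rD; rewrite eq_e cE in cD.
  have eq_b : b = c.
    by have := congr1 odd rD; rewrite !oddD !odd_double !oddb.
  congr (_, _) => //; apply: (@box_inj _ la) => //.
  by move: rD; rewrite eq_b => /addIn/double_inj.
have [|f eK fK] := inj_card_bij e_inj.
  by rewrite card_prod !card_ord card_bool muln2.
by exists e, f; split=> // D b; have [] := eP (D, b).
Qed.

(** In the coefficient of t b at the highest weight word the identity contributes 1 and no column
    permutation contributes a negative amount: one with nonzero contribution permutes the dominoes
    up to flips, and its sign cancels the signs of the entries of the form. *)
Lemma sp_young_op_exists (g k : nat) (la : young k) : (height la <= g)%N ->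
  exists2 t : tensor k.*2 (g + g), sp_invariant t &
    t *m young_op (place_repr k.*2 (g + g)) (young_delta la) != 0.
Proof.
move=> le_la; set l := young_delta la.
have [e [f [eK fK rowE colE']]] := domino_boxes la.
have [|w wP] := @row_word_exists _ g l.
  rewrite leqNgt; apply/negP => lt_l.
  have := young_nth_gt0 l (g + g); rewrite lt_l nth_delta_rows addnn doubleK.
  by rewrite nth_default.
pose t := domino_tensor g e; exists t; first exact: domino_tensor_invariant eK fK.
have w_inj i j : (w i == w j) = (box_row l i == box_row l j).
  by rewrite -!wP (inj_eq (@sp_rank_inj g)).
apply/eqP=> t0; have := tcoef_young_op t w_inj.
rewrite t0 tcoef0 => /esym/eqP; rewrite mulf_eq0 (negPf (card_stab_neq0 _)) /=.
apply/negP; rewrite tcoef_col_op.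
have lt_row (D : 'I_k) : (box_row la D < g)%N by apply: leq_trans (box_row_lt la D) le_la.
have wE D b : w (e (D, b)) =
    if b then rshift g (Ordinal (lt_row D)) else lshift g (Ordinal (lt_row D)).
  apply: sp_rank_inj; rewrite wP rowE; case: b; rewrite ?sp_rankr ?sp_rankl //=.
    by rewrite addn1.
  by rewrite addn0.
have term_ge0 q : q \in col_stab k.*2 l ->
    0 <= (-1) ^+ (odd_perm q) * tcoef t (word_perm w q).
  move=> /col_stabP Cq; have [-> | nz] := eqVneq (tcoef t (word_perm w q)) 0.
    by rewrite mulr0.
  move: nz; rewrite tcoef_domino => /prodf_neq0 nz.
  have qP D : exists x : 'I_k * bool, forall b, q (e (D, b)) = e (x.1, b (+) x.2).
    have := nz D isT; rewrite !ffunE.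
    rewrite -(fK (q (e (D, false)))) -(fK (q (e (D, true)))).
    case E0: (f (q (e (D, false)))) => [D0 b0]; case E1: (f (q (e (D, true)))) => [D1 b1].
    have q0 : q (e (D, false)) = e (D0, b0) by rewrite -E0 fK.
    have q1 : q (e (D, true)) = e (D1, b1) by rewrite -E1 fK.
    rewrite !wE => nzJ.
    have [eq_r eq_b] : box_row la D0 = box_row la D1 /\ b1 = ~~ b0.
      move: nzJ; case: b0 {E0 q0}; case: b1 {E1 q1};
        rewrite ?symp_mxll ?symp_mxlr ?symp_mxrl ?symp_mxrr ?eqxx //;
        by case: (Ordinal (lt_row D0) =P Ordinal (lt_row D1)) => [[->] | _]; rewrite ?oppr0 ?eqxx.
    have eq_D : D0 = D1.
      apply: (@box_inj _ la) => //; rewrite -(colE' D0 b0) -(colE' D1 b1) -q0 -q1 !Cq.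
      by rewrite !colE'.
    by exists (D0, b0) => -[] /=; rewrite ?q1 ?q0 ?eq_b -?eq_D.
  have /fin_all_exists[x xP] := qP.
  have p_inj : injective (fun D => (x D).1).
    move=> D E /= eq_x; have := xP E ((x E).2 (+) (x D).2).
    rewrite -eq_x addbAC addbb addFb -[(x D).2]addFb -xP.
    by move/perm_inj/(can_inj eK) => [->].
  have -> : odd_perm q = \big[addb/false]_D (x D).2.
    by apply: (@odd_perm_domino _ _ e f eK fK q (perm p_inj)) => D b; rewrite xP permE.
  rewrite (big_morph (fun b : bool => (-1) ^+ b : rat) (id1 := 1) (op1 := *%R)) //; last first.
    by move=> a b; rewrite signr_addb.
  rewrite -big_split /= prodr_ge0 // => D _; rewrite !ffunE !xP !wE /=.
  by case: (x D).2; rewrite /= ?symp_mxlr ?symp_mxrl eqxx ?mulN1r ?opprK ?mul1r ler01.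
have term1 : tcoef t (word_perm w 1%g) = 1.
  rewrite tcoef_domino big1 // => D _.
  by rewrite !ffunE !perm1 !wE symp_mxlr eqxx.
rewrite (bigD1 1%g) ?group1 //= odd_perm1 term1 mulr1.
rewrite gt_eqF // ltr_wpDr // sumr_ge0 // => q /andP[Cq _].
exact: term_ge0.
Qed.

(** * Decomposition of the invariants *)

(** The row space of [M] meets its orthogonal complement in 0 by positivity, and the dimensions add
    up. *)
Lemma orth_decomp (R : realFieldType) m n (M : 'M[R]_(m, n)) (t : 'rV[R]_n) :
  exists2 s : 'rV[R]_n, (s <= M)%MS & (t - s) *m M^T = 0.
Proof.
have cap0 : (M :&: kermx M^T)%MS = 0.
  apply/eqP/rowV0P=> v; rewrite sub_capmx => /andP[/submxP[u def_v] /sub_kermxP vM].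
  by apply/eqP; rewrite -dotvv_eq0 {2}def_v trmx_mul mulmxA vM mul0mx mxE.
have full : (1%:M <= M + kermx M^T)%MS.
  rewrite sub1mx /row_full mxrank_disjoint_sum // mxrank_ker mxrank_tr subnKC //.
  exact: rank_leq_col.
have /sub_addsmxP[[u v] /= def_t] := submx_trans (submx1 t) full.
exists (u *m M); first exact: submxMl.
by rewrite def_t addrC addKr -mulmxA mulmx_ker mulmx0.
Qed.

Section YoungModule.
Variables (d n : nat) (rG : mx_representation rat [set: 'S_d]%G n).

Lemma mxmodule_repr m (V : 'M_n) (W : 'M_(m, n)) x :
  mxmodule rG V -> (W <= V)%MS -> (W *m rG x <= V)%MS.
Proof. by move=> modV sWV; apply: mxmodule_trans; rewrite ?inE. Qed.

Lemma mxmodule_row_op m (V : 'M_n) (W : 'M_(m, n)) l :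
  mxmodule rG V -> (W <= V)%MS -> (W *m row_op rG l <= V)%MS.
Proof.
move=> modV sWV; rewrite /row_op mulmx_sumr summx_sub // => p _.
exact: mxmodule_repr.
Qed.

Lemma mxmodule_col_op m (V : 'M_n) (W : 'M_(m, n)) l :
  mxmodule rG V -> (W <= V)%MS -> (W *m col_op rG l <= V)%MS.
Proof.
move=> modV sWV; rewrite /col_op mulmx_sumr summx_sub // => q _.
by rewrite -scalemxAr scalemx_sub ?mxmodule_repr.
Qed.

End YoungModule.

Lemma regular_orthogonal d : orthogonal_repr (Sym_regular d).
Proof.
move=> x; apply/matrixP=> i j; rewrite !mxE !eqxx /=; congr (nat_of_bool _)%:R.
have valP' (y : 'S_d) (h : 'I_#|[set: 'S_d]|) :
    (h == gring_index [set: 'S_d]%G y) = (enum_val h == y).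
  apply/eqP/eqP => [-> | <-]; first by rewrite gring_indexK ?inE.
  by rewrite gring_valK.
rewrite !valP'; apply/eqP/eqP => ->; first by rewrite mulgK.
by rewrite mulgKV.
Qed.

(** * Comparison with Specht modules *)

Section SpechtImage.
Variables (d n : nat) (rG : mx_representation rat [set: 'S_d]%G n).
Variables (l : young d) (t : 'rV[rat]_n).
Hypothesis nz_t : t *m young_op rG l != 0.

Local Notation aG := (Sym_regular d).
Local Notation one := (delta_mx 0 (gring_index [set: 'S_d]%G 1%g) : 'rV[rat]_#|[set: 'S_d]|).

Lemma young_symmetrizerE (l' : seq nat) : young_symmetrizer d l' = one *m young_op aG l'.
Proof.
rewrite /young_symmetrizer /young_op mulmxA /row_op mulmx_sumr; apply: eq_bigr => p _.
rewrite /col_op mulmx_sumr mulmx_suml; apply: eq_bigr => q _.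
by rewrite -scalemxAr -scalemxAl !delta_regular mul1g.
Qed.

(** The intertwiner from the regular module that sends the unit to [t]. *)
Let H : 'M_(#|[set: 'S_d]|, n) := \matrix_i (t *m rG (enum_val i)).

Let oneH : one *m H = t.
Proof. by rewrite -rowE rowK gring_indexK ?inE // repr_mx1 mulmx1. Qed.

Let HJ x : aG x *m H = H *m rG x.
Proof.
apply/row_matrixP=> i; rewrite !row_mul !rowK -rowE rowK gring_indexK ?inE //.
by rewrite repr_mxM ?inE // mulmxA.
Qed.

Let H_young : young_op aG l *m H = H *m young_op rG l.
Proof.
have Hrow : row_op aG l *m H = H *m row_op rG l.
  by rewrite mulmx_suml mulmx_sumr; apply: eq_bigr => p _.
have Hcol : col_op aG l *m H = H *m col_op rG l.
  rewrite mulmx_suml mulmx_sumr; apply: eq_bigr => p _.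
  by rewrite -scalemxAl -scalemxAr HJ.
by rewrite -mulmxA Hrow mulmxA Hcol mulmxA.
Qed.

Let S := specht_mx l.
Local Notation U := (cyclic_mx rG (t *m young_op rG l)).

Let S_cyclic : S = cyclic_mx aG (one *m young_op aG l).
Proof. by rewrite /S /specht_mx young_symmetrizerE. Qed.

(** A nonzero u in the Specht module is mapped by some [x c] to a nonzero multiple of the generator;
    if [u H = 0], applying [H] gives [t c = 0]. *)
Let H_inj (u : 'rV_#|[set: 'S_d]|) : (u <= S)%MS -> u *m H = 0 -> u = 0.
Proof.
rewrite S_cyclic => Su uH0; apply/eqP/negPn/negP => nz_u.
have [x [a [nz_a ucE]]] := young_cyclic_detect (@regular_orthogonal d) Su nz_u.
case/eqP: nz_t; apply: (scalerI nz_a); rewrite scaler0.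
have := congr1 (mulmx^~ H) ucE.
rewrite /= -(mulmxA (u *m aG x)) H_young -scalemxAl -(mulmxA one) H_young.
rewrite [one *m _]mulmxA oneH => <-.
by rewrite mulmxA -(mulmxA u) HJ [u *m _]mulmxA uH0 !mul0mx.
Qed.

Let SH_U : (S *m H :=: U)%MS.
Proof.
have modSH : mxmodule rG <<S *m H>>%MS.
  apply/mxmoduleP=> x Gx; rewrite (eqmxMr _ (genmxE _)) genmxE -mulmxA -HJ mulmxA submxMr //.
  by rewrite (mxmoduleP (specht_mx_module l)).
apply/eqmxP/andP; split.
  apply/row_subP=> i; rewrite row_mul.
  have := row_sub i S; rewrite {2}S_cyclic => /cyclic_sumP[a ->].
  rewrite mulmx_suml summx_sub // => x _; rewrite -scalemxAl scalemx_sub //.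
  rewrite -mulmxA HJ mulmxA -(mulmxA one) H_young mulmxA oneH.
  by rewrite mxmodule_repr ?cyclic_mx_module ?cyclic_mx_id.
rewrite -(genmxE (S *m H)); apply: cyclic_mx_sub => //.
rewrite genmxE -oneH -mulmxA -H_young mulmxA submxMr // S_cyclic.
exact: cyclic_mx_id.
Qed.

Lemma young_cyclic_specht : exists Umod : mxmodule rG U,
  mx_rsim (submod_repr Umod) (specht_repr l).
Proof.
exists (cyclic_mx_module rG _); apply: mx_rsim_sym.
have valH m (v : 'M_(m, \rank S)) : (val_submod v *m H <= U)%MS.
  by rewrite -SH_U submxMr ?val_submodP.
pose B : 'M_(\rank S, \rank U) := in_submod U (val_submod 1%:M *m H).
have BE m (v : 'M_(m, \rank S)) : v *m B = in_submod U (val_submod v *m H).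
  by rewrite /B !(in_submodE _ (val_submod _ *m H)) (val_submodE v) !mulmxA.
exists B.
- rewrite -SH_U; apply/esym/mxrank_injP/rowV0P=> v.
  by rewrite sub_capmx => /andP[Sv /sub_kermxP]; apply: H_inj.
- apply: inj_row_free => v; rewrite BE => vB0.
  have vH0 : val_submod v *m H = 0.
    by rewrite -(in_submodK (valH _ v)) vB0 linear0.
  by apply/eqP; rewrite -val_submod_eq0 (H_inj _ vH0) ?val_submodP.
move=> x Gx; rewrite BE.
have -> : val_submod (specht_repr l x) = val_submod 1%:M *m aG x.
  by rewrite -(val_submodJ (specht_mx_module l)) // mul1mx.
rewrite -(mulmxA (val_submod _)) HJ (mulmxA (val_submod _)).
  by rewrite (in_submodJ (cyclic_mx_module rG _)) ?valH.
Qed.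

End SpechtImage.

(** * The orthogonal decomposition *)

Lemma young_delta_inj k : injective (@young_delta k).
Proof.
move=> l l' eq_l; apply: young_eq => r.
have eq_d : delta_rows l = delta_rows l' := congr1 (@young_rows _) eq_l.
by have := nth_delta_rows l r.*2; rewrite eq_d nth_delta_rows doubleK.
Qed.

Theorem theorem1p1 (g k : nat) (g_gt0 : (0 < g)%N) (k_gt0 : (0 < k)%N) :
  (forall t : tensor k.*2 (g + g),
     sp_invariant t -> t != 0 -> 0 < mu_tensor t t)
  /\
  exists U : young k -> 'M[rat]_#|{: word k.*2 (g + g)}|,
    [/\ forall t : tensor k.*2 (g + g),
          sp_invariant t <-> (t <= \sum_(l | (height l <= g)%N) U l)%MS,
        mxdirect (\sum_(l | (height l <= g)%N) U l),
        forall l l' : young k, (height l <= g)%N -> (height l' <= g)%N ->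
          l != l' ->
          forall s t : tensor k.*2 (g + g),
            (s <= U l)%MS -> (t <= U l')%MS -> mu_tensor s t = 0
      & forall l : young k, (height l <= g)%N ->
          mxsimple (place_repr k.*2 (g + g)) (U l) /\
          exists Umod : mxmodule (place_repr k.*2 (g + g)) (U l),
            mx_rsim (submod_repr Umod) (specht_repr (young_delta l))].
Proof.
split=> [t t_inv nz_t | ]; first by rewrite mu_tensor_invariant // dotvv_gt0.
set rG := place_repr k.*2 (g + g); pose c (l : young k) := young_op rG (young_delta l).
have orthG : orthogonal_repr rG by apply: place_orthogonal.
(* For diagrams that are too tall the generator defaults to 0, so that it can be chosen for all [l]
   at once. *)
have gen_ex (l : young k) : exists t : tensor k.*2 (g + g),
    sp_invariant t /\ ((height l <= g)%N -> t *m c l != 0).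
  case: (leqP (height l) g) => [le_l | _]; last by exists 0; split=> //; apply: sp_invariant0.
  by have [t] := sp_young_op_exists le_l; exists t.
have /fin_all_exists[T TP] := gen_ex.
pose U l := cyclic_mx rG (T l *m c l); exists U.
have U_inv l t : (t <= U l)%MS -> sp_invariant t.
  case/cyclic_sumP=> a ->; apply: sp_invariant_sum => x _.
  apply/sp_invariantZ/sp_invariant_place/sp_invariant_young_op.
  by have [] := TP l.
have U_orth l l' (s t : tensor k.*2 (g + g)) :
    l != l' -> (s <= U l)%MS -> (t <= U l')%MS -> s *m t^T = 0.
  move=> ne_l Us Ut; apply: (young_cyclic_orthogonal orthG _ Us Ut).
  by rewrite (inj_eq (@young_delta_inj k)).
set W := (\sum_(l | _) U l)%MS.
have W_inv t : (t <= W)%MS -> sp_invariant t.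
  case/sub_sumsmxP=> u ->; apply: sp_invariant_sum => l _.
  exact: U_inv (submxMl _ _).
have modW : mxmodule rG W by apply: sumsmx_module => l _; apply: cyclic_mx_module.
split=> [t | | l l' _ _ ne_l s t Us Ut | l le_l].
- split=> [t_inv | ]; last exact: W_inv.
  have [s sW tsW] := orth_decomp W t.
  suff /eqP : t - s = 0 by rewrite subr_eq0 => /eqP->.
  have ts_inv : sp_invariant (t - s).
    by rewrite -scaleN1r; apply: sp_invariantD => //; apply/sp_invariantZ/W_inv.
  (* The component [u] of [t] orthogonal to [W] is null: a nonzero [u x c] would, by uniqueness, be
     a multiple of a generator and lie in [W]. *)
  apply: (young_null_eq0 orthG) => l x; set u := t - s in tsW ts_inv *.
  apply/eqP/negPn/negP => nz.
  have ux_inv : sp_invariant (u *m rG x) by apply: sp_invariant_place.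
  have [la [def_l le_la]] := sp_young_op_shape ux_inv nz.
  have [T_inv /(_ le_la) nz_T] := TP la; rewrite /c -def_l in nz_T.
  have [a ucE] := sp_young_op_unique ux_inv T_inv nz_T.
  have ucW : (u *m rG x *m young_op rG l <= W)%MS.
    rewrite -/rG ucE scalemx_sub // def_l.
    by apply: (sumsmx_sup la) => //; apply: cyclic_mx_id.
  (* The square norm of [u x c] is the product of [u] with an element of [W], since [W] is stable
     and the action orthogonal. *)
  case/eqP: nz; apply: mulmx_tr_eq0.
  move def_v: (_^T) => v; have vW : (v^T <= W)%MS by rewrite -def_v trmxK.
  rewrite /young_op -!mulmxA.
  have : ((rG x *m (col_op rG l *m (row_op rG l *m v)))^T <= W)%MS.
    rewrite !trmx_mul tr_row_op // tr_col_op // orthG.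
    by rewrite mxmodule_repr ?mxmodule_col_op ?mxmodule_row_op.
  case/submxP=> z /(congr1 trmx); rewrite trmxK => ->.
  by rewrite trmx_mul mulmxA tsW mul0mx.
- apply/mxdirect_sumsP=> l le_l; apply/eqP/rowV0P=> v.
  rewrite sub_capmx => /andP[Uv /sub_sumsmxP[u def_v]].
  apply/eqP; rewrite -dotvv_eq0 {2}def_v raddf_sum mulmx_sumr big1 ?mxE // => l' /andP[_ ne_l].
  by apply: U_orth Uv (submxMl _ _); rewrite eq_sym.
- by rewrite mu_tensor_invariant ?(U_orth l l') ?mxE //; apply: U_inv Us.
have nz_T : T l *m c l != 0 by have [_] := TP l; apply.
split; first exact: young_cyclic_simple.
exact: young_cyclic_specht.
Qed.
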